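(* Let $F$ be an exponential functor with $\deg(F(t_1))>0$. Then $H^k_{\pi_1(\mathbb T^2)}(\mathfrak t;\mathcal R_{\mathbb Q})=0$ for $k\ne2$ and $$H^2_{\pi_1(\mathbb T^2)}(\mathfrak t;\mathcal R_{\mathbb Q})\cong R_F(\mathbb T^2)\otimes\mathbb Q/(F(t_2)-F(t_1),F(t_3)-F(t_2)).$$ Moreover, the Weyl group $W=S_3$ acts on $H^2_{\pi_1(\mathbb T^2)}(\mathfrak t;\mathcal R_{\mathbb Q})$ by signed permutations, i.e. under this isomorphism $w\in W$ acts by $[p]\mapsto\mathrm{sgn}(w)[w(p)]$, where $w(p)$ permutes the variables $t_1,t_2,t_3$.
   Context: An exponential functor is a functor $F$ on finite-dimensional complex inner product spaces and unitary isomorphisms, preserving adjoints, with natural unitary isomorphisms $F(V\oplus W)\cong F(V)\otimes F(W)$, $F(0)\cong\mathbb C$, associative and unital. $\mathbb T^2\subset SU(3)$ is the diagonal maximal torus, $R(\mathbb T^2)\cong\mathbb Z[t_i^{\pm1}]/(t_1t_2t_3-1)$ with $t_i$ the $i$-th diagonal entry, $F(t_i)$ the character of $F(\mathbb C)$ with $\mathbb T^2$ acting via $t_i$, $\deg(F(t_1))$ the highest power of $t_1$ in it, and $R_F(\mathbb T^2)=R(\mathbb T^2)[(F(t_1)F(t_2)F(t_3))^{-1}]$. $\mathfrak t=\{h\in\mathbb R^3:h_1+h_2+h_3=0\}$ and $\pi_1(\mathbb T^2)=\Lambda=\{k\in\mathbb Z^3:k_1+k_2+k_3=0\}$ acts on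 $\mathfrak t$ by translation and on $R_F(\mathbb T^2)\otimes\mathbb Q$ by multiplication with $F(t_1)^{k_1}F(t_2)^{k_2}F(t_3)^{k_3}$. The equivariant cohomology $H^*_{\Lambda}(\mathfrak t;\mathcal R_{\mathbb Q})$ is the cohomology of the cochain complex $\mathrm{Hom}_{\mathbb Q[\Lambda]}(C_*(\mathfrak t)\otimes\mathbb Q,R_F(\mathbb T^2)\otimes\mathbb Q)$, with $C_*(\mathfrak t)$ the cellular chain complex of $\mathfrak t$ as a $\Lambda$-CW-complex. $W=S_3$ acts on $\mathfrak t$, $\Lambda$ and $R_F(\mathbb T^2)$ by permuting coordinates/variables, and on cochains by $(w\cdot\phi)(c)=w\phi(w^{-1}c)$, inducing an action on cohomology. *)

(* Defs.v *)
From HB Require Import structures.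
From mathcomp Require Import all_boot all_order all_algebra all_fingroup.
From mathcomp Require Import reals.
From mathcomp Require Import complex mxtens.

Set Implicit Arguments.
Unset Strict Implicit.
Unset Printing Implicit Defensive.

Import Order.TTheory GRing.Theory Num.Theory.
Local Open Scope ring_scope.

(* We work with the skeleton of the category of finite-dimensional complex *)
(* inner product spaces and unitary isomorphisms: objects C^n (n : nat),    *)
(* morphisms unitary n x n matrices.  Linear maps act on ROW vectors        *)
(* (x |-> x *m A), so "first U then V" is U *m V.  V (+) W = C^(n+m) with   *)
(* U (+) U' = block_mx U 0 0 U', and C^a (x) C^b = C^(a*b) via the          *)
(* Kronecker product tensmx (row-major indices).                            *)

Section ExpFun.
Variable R : realType.
Local Notation C := (R[i]).

Definition adjmx n m (A : 'M[C]_(n, m)) : 'M[C]_(m, n) := (map_mx conjc A)^T.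

Definition unitarymx n m (A : 'M[C]_(n, m)) : Prop :=
  A *m adjmx A = 1%:M /\ adjmx A *m A = 1%:M.

(* the data of a functor F together with the structure maps
   edist n m : F(C^n (+) C^m) -> F(C^n) (x) F(C^m)  and  eunit : F(0) -> C *)
Record expfun := ExpFun {
  edim  : nat -> nat;
  efun  : forall n, 'M[C]_n -> 'M[C]_(edim n);
  edist : forall n m, 'M[C]_(edim (n + m), edim n * edim m);
  eunit : 'M[C]_(edim 0, 1)
}.

Definition is_exponential_functor (F : expfun) : Prop :=
  [/\ (forall n, efun F (1%:M : 'M_n) = 1%:M),
      (forall n (U V : 'M_n), unitarymx U -> unitarymx V ->
          efun F (U *m V) = efun F U *m efun F V),
      (forall n (U : 'M_n), unitarymx U -> unitarymx (efun F U)),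
      (forall n (U : 'M_n), unitarymx U -> efun F (adjmx U) = adjmx (efun F U)) &
  [/\
      (forall n m, unitarymx (edist F n m)),
      (forall n m (U : 'M_n) (V : 'M_m), unitarymx U -> unitarymx V ->
          efun F (block_mx U 0 0 V) *m edist F n m
          = edist F n m *m tensmx (efun F U) (efun F V)),
      unitarymx (eunit F),
      (forall n m k,
          edist F (n + m) k *m tensmx (edist F n m) 1%:M
          = castmx (congr1 (edim F) (addnA n m k), mulnA (edim F n) (edim F m) (edim F k))
                   (edist F n (m + k) *m tensmx 1%:M (edist F m k))) &
      (forall n,
          castmx (congr1 (edim F) (add0n n), mul1n (edim F n))
                 (edist F 0 n *m tensmx (eunit F) 1%:M) = 1%:M) /\
      (forall n,
          castmx (congr1 (edim F) (addn0 n), muln1 (edim F n))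
                 (edist F n 0 *m tensmx 1%:M (eunit F)) = 1%:M)]].

(* the character of F(C) (with U(1) acting on C) is the Laurent polynomial
   t^-m * P(t) *)
Definition character_is (F : expfun) (m : nat) (P : {poly int}) : Prop :=
  forall z : C, z * conjc z = 1 ->
    \tr (efun F (z%:M : 'M_1)) = (z ^+ m)^-1 * (map_poly (fun c : int => c%:~R) P).[z].

End ExpFun.

(* R(T^2) (x) Q = Q[t1^+-1, t2^+-1] (t3 = (t1 t2)^-1) is realised inside the *)
(* fraction field K of Q[t1, t2] = {poly {poly rat}} (outer variable t1).   *)

Definition Tpol := {poly {poly rat}}.
Definition Kfr := {fraction Tpol}.

Definition tof (q : Tpol) : Kfr := FracField.tofrac q.

Definition t1 : Kfr := tof 'X.
Definition t2 : Kfr := tof ('X : {poly rat})%:P.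
Definition tvar (i : 'I_3) : Kfr := [:: t1; t2; (t1 * t2)^-1]`_i.

Definition pev (m : nat) (P : {poly int}) (x : Kfr) : Kfr :=
  (x ^+ m)^-1 * (map_poly (fun c : int => c%:~R) P).[x].

Definition Ft m P (i : 'I_3) : Kfr := pev m P (tvar i).
Definition Fprod m P : Kfr := Ft m P 0 * Ft m P 1 * Ft m P 2.

(* membership in R_F(T^2) (x) Q = Q[t1^+-1,t2^+-1][(F(t1)F(t2)F(t3))^-1] *)
Definition inRF m P (x : Kfr) : Prop :=
  exists (q : Tpol) (k n : nat), x * (t1 * t2) ^+ k * Fprod m P ^+ n = tof q.

Definition inIdeal m P (x : Kfr) : Prop :=
  exists a b, [/\ inRF m P a, inRF m P b &
     x = a * (Ft m P 1 - Ft m P 0) + b * (Ft m P 2 - Ft m P 1)].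

(* W = S_3 acts by permuting the variables: t_i |-> t_(w i).  On a fraction
   num/den this is evaluation of num and den at (t_(w 0), t_(w 1)). *)
Definition evT (s1 s2 : Kfr) (q : Tpol) : Kfr :=
  (map_poly (fun c : {poly rat} => (map_poly (fun r : rat => ratr r) c).[s2]) q).[s1].

Definition sigmaW (w : 'S_3) (x : Kfr) : Kfr :=
  let s1 := tvar (w 0) in let s2 := tvar (w 1) in
  evT s1 s2 (frac (generic_quotient.repr x)).1 / evT s1 s2 (frac (generic_quotient.repr x)).2.

(* t = {h in R^3 | h1+h2+h3 = 0} with its alcove (Weyl) triangulation: the  *)
(* lines h_i - h_j in Z.  A vertex h is encoded by v = 3h in Z^3 (vertices  *)
(* are exactly the h with all h_i - h_j in Z).  Two vertices are joined by  *)
(* an edge iff v' - v = +-(3 e_i - (1,1,1)); k-simplices are (k+1)-cliques. *)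
(* Oriented k-simplices are ordered lists of k+1 vertices, and the cellular *)
(* cochains are the alternating functions on them.                          *)

Definition vtx := {ffun 'I_3 -> int}.

Definition isvtx (v : vtx) : bool :=
  (\sum_i v i == 0) && [forall i, forall j, (3 %| v i - v j)%Z].

Definition avec (i : 'I_3) : vtx := [ffun j => if j == i then 2%:Z else -1].

Definition vadd (v w : vtx) : vtx := [ffun j => v j + w j].

Definition edge (v v' : vtx) : bool :=
  [&& isvtx v, isvtx v' & [exists i, (v' == vadd v (avec i)) || (v == vadd v' (avec i))]].

Definition simplex (k : nat) (s : seq vtx) : bool :=
  (size s == k.+1) && all isvtx s && pairwise edge s.

(* Lambda = pi_1(T^2) = {k in Z^3 | k1+k2+k3 = 0}, acting on t by translation *)
Definition inLam (k : vtx) : bool := \sum_i k i == 0.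
Definition vtr (k : vtx) (v : vtx) : vtx := [ffun j => v j + 3 * k j].

Definition uLam m P (k : vtx) : Kfr := \prod_(i < 3) Ft m P i ^ (k i).

Definition vperm (w : 'S_3) (v : vtx) : vtx := [ffun j => v ((w^-1)%g j)].

Definition cochain m P (k : nat) (phi : seq vtx -> Kfr) : Prop :=
  [/\ (forall s, simplex k s -> inRF m P (phi s)),
      (forall s1 x y s2, simplex k (s1 ++ x :: y :: s2) ->
          phi (s1 ++ y :: x :: s2) = - phi (s1 ++ x :: y :: s2)) &
      (forall kk s, inLam kk -> simplex k s ->
          phi (map (vtr kk) s) = uLam m P kk * phi s)].

Definition delta (k : nat) (phi : seq vtx -> Kfr) (s : seq vtx) : Kfr :=
  \sum_(i < k.+2) (-1) ^+ i * phi (take i s ++ drop i.+1 s).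

Definition cocycle (k : nat) (phi : seq vtx -> Kfr) : Prop :=
  forall s, simplex k.+1 s -> delta k phi s = 0.

Definition coboundary m P (k : nat) (phi : seq vtx -> Kfr) : Prop :=
  match k with
  | 0 => forall s, simplex 0 s -> phi s = 0
  | k'.+1 => exists psi, cochain m P k' psi /\
               forall s, simplex k s -> phi s = delta k' psi s
  end.

Definition wact (w : 'S_3) (phi : seq vtx -> Kfr) (s : seq vtx) : Kfr :=
  sigmaW w (phi (map (vperm (w^-1)%g) s)).

(* Main.v *)
(* Summing a 2-cochain over the six oriented triangles around the origin maps
   coboundaries onto the ideal I = (F(t2) - F(t1), F(t3) - F(t2)): the spokes of
   the hexagon cancel and opposite boundary edges differ by a translation in
   Lambda.  Solving around the hexagon gives the converse, hence H^2 = R_F / I.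
   Translation by e_i - e_j is homotopic to the identity along a path of two
   edges, so a 1-cocycle is the coboundary of some psi with values in the
   fraction field such that (F(t_i)/F(t_j) - 1) psi lies in R_F for all i, j.
   Thus H^1 = 0 as soon as an element c of the fraction field with c I in R_F
   lies in R_F.

   Let T(f) be the companion matrix of P - f X^m and N(f) the determinant of
   T(f) (x) T(f) (x) T(f) - 1.  As t1 t2 t3 = 1, the determinant of
   T(F(t1)) (x) T(F(t2)) (x) T(F(t3)) - 1 vanishes, so N(F(t_i)) is in I.  Hence
   a polynomial in t1 alone and one in t2 alone both clear the denominator of c;
   they are coprime, provided N is nonzero.  And N(0) is nonzero because three
   roots of P never have product 1: all roots of P are real and nonpositive.

   The latter follows an argument of Thoma.  The function U |-> tr F(U) is
   positive definite on U(n) and equals the product of F over the eigenvalues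
   of U.  Testing it on cycles through a common point, in N disjoint blocks with
   N going to infinity, shows that the Hankel form of the sequence
   prod_rho (x^k - rho^k) (up to signs) is nonnegative for x > 0.  This sequence
   is an exponential sum indexed by the sets of roots rho; for large x the
   singletons can be isolated by interpolation, which forces rho <= 0. *)
Require Import Defs.
From HB Require Import structures.
From mathcomp Require Import all_boot all_order all_algebra all_fingroup.
From mathcomp Require Import reals.
From mathcomp Require Import complex mxtens.
From mathcomp Require Import cyclic separable cyclotomic ring zify.
Import Order.TTheory GRing.Theory Num.Theory.
Local Open Scope ring_scope.

Set Implicit Arguments.
Unset Strict Implicit.
Unset Printing Implicit Defensive.

Local Notation unitary := Defs.unitarymx.
Local Notation tens3 A B C := (tensmx (tensmx A B) C).

(** * Traces of an exponential functor on unitary matrices *)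

Lemma mxtrace_tens (S : comPzRingType) (n p : nat) (A : 'M[S]_n) (B : 'M[S]_p) :
  \tr (tensmx A B) = \tr A * \tr B.
Proof.
rewrite /mxtrace (@mxtens.mulr_sum _ n p); apply: eq_bigr => i _.
by case: (mxtens_indexP i) => k j; rewrite tensmxE mxtens_indexK.
Qed.

Section UnitaryTrace.
Variables (R : realType) (F : expfun R).
Local Notation C := (R[i]).
Hypothesis expF : is_exponential_functor F.

Lemma efun1 n : efun F (1%:M : 'M_n) = 1%:M.
Proof. by case: expF. Qed.

Lemma efunM n (U V : 'M_n) : unitary U -> unitary V ->
  efun F (U *m V) = efun F U *m efun F V.
Proof. by case: expF => _ + _ _ _; apply. Qed.

Lemma efun_adj n (U : 'M_n) : unitary U -> efun F (adjmx U) = adjmx (efun F U).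
Proof. by case: expF => _ _ _ + _; apply. Qed.

Lemma efun_unitary n (U : 'M_n) : unitary U -> unitary (efun F U).
Proof. by case: expF => _ _ + _ _; apply. Qed.

Lemma efun0_trace (U : 'M_0) : \tr (efun F U) = 1.
Proof.
have -> : U = 1%:M by rewrite thinmx0 [RHS]thinmx0.
case: expF => F1 _ _ _ [_ _ [u1 u2] _ _].
by rewrite F1 -u1 mxtrace_mulC u2 mxtrace1.
Qed.

(** Naturality of [edist] makes F of a block sum unitarily conjugate to the tensor product, and the
    trace is invariant under conjugation. *)
Lemma efun_block_trace n p (U : 'M_n) (V : 'M_p) :
  unitary U -> unitary V ->
  \tr (efun F (block_mx U 0 0 V)) = \tr (efun F U) * \tr (efun F V).
Proof.
move=> uU uV; case: expF => _ _ _ _ [dU dN _ _ _].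
have [d1 d2] := dU n p.
rewrite -mxtrace_tens -[efun F (block_mx _ _ _ _)]mulmx1 -d1 mulmxA dN //.
by rewrite -mulmxA mxtrace_mulC -mulmxA d2 mulmx1.
Qed.

Lemma adjmxK n p (A : 'M[C]_(n, p)) : adjmx (adjmx A) = A.
Proof. by apply/matrixP=> i j; rewrite !mxE conjcK. Qed.

Lemma adjmx_unitary n p (A : 'M[C]_(n, p)) : unitary A -> unitary (adjmx A).
Proof. by case=> u1 u2; split; rewrite adjmxK. Qed.

Lemma adjmxM n p q (A : 'M[C]_(n, p)) (B : 'M[C]_(p, q)) :
  adjmx (A *m B) = adjmx B *m adjmx A.
Proof. by rewrite /adjmx map_mxM trmx_mul. Qed.

Lemma mulmx_unitary n p q (A : 'M[C]_(n, p)) (B : 'M[C]_(p, q)) :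
  unitary A -> unitary B -> unitary (A *m B).
Proof.
move=> [a1 a2] [b1 b2]; split; rewrite adjmxM.
  by rewrite mulmxA -[A *m B *m _]mulmxA b1 mulmx1.
by rewrite mulmxA -[_ *m adjmx A *m A]mulmxA a2 mulmx1.
Qed.

Lemma adjmx_diag n (z : 'rV[C]_n) :
  adjmx (diag_mx z) = diag_mx (map_mx conjc z).
Proof.
apply/matrixP=> i j; rewrite !mxE eq_sym.
by case: eqP => [->|_]; rewrite ?mulr1n ?mulr0n ?conjc0.
Qed.

Lemma diag_unitary n (z : 'rV[C]_n) :
  (forall i, z 0 i * conjc (z 0 i) = 1) -> unitary (diag_mx z).
Proof.
move=> z1; split; rewrite adjmx_diag mulmx_diag.
  rewrite -[RHS]diag_const_mx; congr diag_mx.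
  by apply/rowP=> i; rewrite !mxE z1.
rewrite -[RHS]diag_const_mx; congr diag_mx.
by apply/rowP=> i; rewrite !mxE mulrC z1.
Qed.

Lemma diag_unitaryP n (z : 'rV[C]_n) :
  unitary (diag_mx z) -> forall i, z 0 i * conjc (z 0 i) = 1.
Proof.
move=> [+ _] i; rewrite adjmx_diag mulmx_diag => /matrixP /(_ i i).
by rewrite !mxE eqxx !mulr1n.
Qed.

Lemma scalar_unitary n (z : C) : z * conjc z = 1 -> unitary (z%:M : 'M[C]_n).
Proof.
by move=> z1; rewrite -diag_const_mx; apply: diag_unitary => i; rewrite mxE.
Qed.

Lemma efun_diag_trace n (z : 'rV[C]_n) : (forall i, z 0 i * conjc (z 0 i) = 1) ->
  \tr (efun F (diag_mx z)) = \prod_i \tr (efun F ((z 0 i)%:M : 'M_1)).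
Proof.
elim: n z => [|n IHn] z z1; first by rewrite efun0_trace big_ord0.
have -> : diag_mx z = block_mx ((z 0 0)%:M : 'M_1) 0 0 (diag_mx (rsubmx (z : 'rV_(1 + n)))).
  have e1 : diag_mx (lsubmx (z : 'rV_(1 + n))) = (z 0 0)%:M.
    by rewrite [LHS]mx11_scalar !mxE eqxx mulr1n; congr ((z _ _)%:M); apply: val_inj.
  by rewrite -e1; have := diag_mx_row (lsubmx (z : 'rV_(1 + n))) (rsubmx (z : 'rV_(1 + n))); rewrite hsubmxK => <-.
have zr i : rsubmx (z : 'rV_(1 + n)) 0 i = z 0 (lift 0 i).
  by rewrite mxE; congr (z _ _); apply: val_inj.
etransitivity.
  apply: (@efun_block_trace 1 n); first exact: scalar_unitary.
  by apply: diag_unitary => i; rewrite zr.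
rewrite IHn ?big_ord_recl; last by move=> i; rewrite zr.
by congr (_ * _); apply: eq_bigr => i _; rewrite zr.
Qed.

Lemma conjcE (z : C) : Num.conj z = conjc z.
Proof. by []. Qed.

Lemma unitary_spectral n (U : 'M[C]_n) : unitary U ->
  exists (V : 'M[C]_n) (l : 'rV[C]_n),
    [/\ unitary V, (forall i, l 0 i * conjc (l 0 i) = 1) &
        U = adjmx V *m diag_mx l *m V].
Proof.
move=> [u1 u2].
have adjE (A : 'M[C]_n) : (map_mx Num.conj A^T) = adjmx A by rewrite -map_trmx.
have nU : U \is normalmx by apply/normalmxP; rewrite adjE u1 u2.
have /orthomx_spectralP eU := nU.
have uV : unitary (spectralmx U).
  have /unitarymxP uV := spectral_unitarymx U; rewrite adjE in uV.
  by split=> //; apply: mulmx1C.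
have uVE : invmx (spectralmx U) = adjmx (spectralmx U).
  by rewrite invmx_unitary ?spectral_unitarymx // adjE.
rewrite uVE in eU.
move: (spectralmx U) (spectral_diag U) eU uV {uVE} => V l eU uV.
exists V, l; split => //.
apply: diag_unitaryP.
have -> : diag_mx l = V *m U *m adjmx V.
  case: uV => v1 v2.
  by rewrite eU !mulmxA v1 mul1mx -mulmxA v1 mulmx1.
apply: mulmx_unitary; last exact: adjmx_unitary.
exact: mulmx_unitary.
Qed.

End UnitaryTrace.

(** Newton interpolation: the value at a new point is corrected by a multiple of the polynomial that
    vanishes at the earlier points. *)
Lemma poly_interpolation (K : fieldType) (s : seq K) (g : K -> K) :
  exists q : {poly K}, forall y, y \in s -> q.[y] = g y.
Proof.
elim: s => [|x s [q qP]]; first by exists 0.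
have [xs|xs] := boolP (x \in s).
  by exists q => y; rewrite inE => /predU1P[->|]; apply: qP.
set V := \prod_(y <- s) ('X - y%:P).
have Vx : V.[x] != 0 by rewrite -[_ == 0]/(root V x) root_prod_XsubC.
exists (q + ((g x - q.[x]) / V.[x]) *: V) => y.
rewrite inE hornerD hornerZ => /predU1P[->|ys]; first by rewrite mulfVK //; ring.
have -> : V.[y] = 0 by apply/eqP; rewrite -[_ == 0]/(root V y) root_prod_XsubC.
by rewrite mulr0 addr0 qP.
Qed.

(** In characteristic 0 the polynomial ['X^n - 1] is separable, so it has n distinct roots, enough
    for one of them to be primitive. *)
Lemma primitive_root_exists (K : numClosedFieldType) n :
  (n > 0)%N -> exists w : K, n.-primitive_root w.
Proof.
move=> n0; have [r e] := closed_field_poly_normal ('X^n - 1 : {poly K}).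
have l1 : lead_coef ('X^n - 1 : {poly K}) = 1 by apply/eqP; exact: monicXnsubC.
rewrite l1 scale1r in e.
have ur : uniq r.
  rewrite -separable_prod_XsubC -e separable_Xn_sub_1 // pnatr_eq0.
  by rewrite -lt0n.
have sr : size r = n.
  by have := congr1 (fun p : {poly K} => size p) e; rewrite size_prod_XsubC size_XnsubC // => -[].
have ar : all n.-unity_root r.
  apply/allP=> x xr; rewrite /root_of_unity; rewrite e.
  by rewrite root_prod_XsubC.
have := has_prim_root n0 ar ur; rewrite sr leqnn => /(_ isT) /hasP[w _ wp].
by exists w.
Qed.

(** * Positive definiteness of the trace and the weight spaces of the scalars *)

Section Positivity.
Variables (R : realType) (F : expfun R).
Local Notation C := (R[i]).
Hypothesis expF : is_exponential_functor F.

Lemma conjc_ge0 (x : C) : 0 <= conjc x * x.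
Proof. by rewrite -conjcE mulrC -normCK exprn_ge0. Qed.

(** All the F(w^a) are powers of the single unitary F(w), so one diagonalization serves every
    exponent. *)
Lemma efun_scalar_pow n (w : C) : w * conjc w = 1 ->
  exists (V : 'M[C]_(edim F n)) (h : 'rV[C]_(edim F n)),
  unitary V /\ forall a, efun F ((w ^+ a)%:M : 'M_n)
     = adjmx V *m diag_mx (map_mx (fun x => x ^+ a) h) *m V.
Proof.
move=> w1; have uw := @scalar_unitary R n _ w1.
have [V [h [uV h1 e]]] := @unitary_spectral R _ _ (efun_unitary expF uw).
exists V, h; split=> // a; case: (uV) => v1 v2.
elim: a => [|a IHa].
  rewrite expr0 efun1 //.
  have -> : map_mx (fun x => x ^+ 0) h = const_mx 1 by apply/rowP=> i; rewrite !mxE.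
  by rewrite diag_const_mx mulmx1 v2.
have wa : w ^+ a * conjc (w ^+ a) = 1 by rewrite rmorphXn -exprMn w1 expr1n.
rewrite exprS scalar_mxM efunM //; last exact: scalar_unitary.
rewrite IHa e !mulmxA -[_ *m V *m adjmx V]mulmxA v1 mulmx1.
rewrite -[_ *m diag_mx h *m diag_mx _]mulmxA mulmx_diag; congr (_ *m diag_mx _ *m _).
by apply/rowP=> i; rewrite !mxE exprS.
Qed.

(* The coefficients of the sum are the traces of X^* X on the weight spaces of
   the scalars, where X is the sum of the [c j *: F(U j)]. *)
Lemma gram_coef_ge0 n (J : finType) (c : J -> C) (U : J -> 'M[C]_n)
    (S : J -> J -> {poly C}) (D k : nat) :
  (forall j, unitary (U j)) ->
  (forall j l, (size (S j l) <= D.+1)%N) ->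
  (forall j l z, z * conjc z = 1 ->
     \tr (efun F (z%:M *m (adjmx (U j) *m U l))) = (z ^+ k)^-1 * (S j l).[z]) ->
  forall w, 0 <= (\sum_j \sum_l (conjc (c j) * c l) *: S j l)`_w.
Proof.
move=> uU sS trS w0; set T := \sum_j _.
have sT : (size T <= D.+1)%N.
  apply: leq_trans (size_sum _ _ _) _; apply/bigmax_leqP => j _.
  apply: leq_trans (size_sum _ _ _) _; apply/bigmax_leqP => l _.
  exact: leq_trans (size_scale_leq _ _) _.
have [w0D|w0D] := ltnP w0 D.+1; last by rewrite nth_default // (leq_trans sT).
(* The order D + 1 makes the powers of w with exponents 0 to D distinct, so that they separate the
   coefficients of [T]. *)
have [w wP] := @primitive_root_exists C D.+1 isT.
have w1 : w * conjc w = 1.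
  rewrite -conjcE -normCK.
  have : `|w| ^+ D.+1 = 1 by rewrite -normrX (prim_expr_order wP) normr1.
  by move/eqP; rewrite pexpr_eq1 ?normr_ge0 // => /eqP ->; rewrite expr1n.
have w_neq0 : w != 0 by apply/eqP=> w00; move/eqP: w1; rewrite w00 mul0r eq_sym oner_eq0.
have wa1 a : w ^+ a * conjc (w ^+ a) = 1 by rewrite rmorphXn -exprMn w1 expr1n.
have [V [h [uV hP]]] := efun_scalar_pow n w1.
pose X := \sum_l c l *: efun F (U l).
(* [p i] is the squared norm of the i-th column of X times the adjoint of V. *)
pose p i := (V *m adjmx X *m X *m adjmx V) i i.
have p0 i : 0 <= p i.
  have -> : p i = (adjmx (X *m adjmx V) *m (X *m adjmx V)) i i.
    by rewrite /p adjmxM adjmxK !mulmxA.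
  rewrite mxE; apply: sumr_ge0 => j _; rewrite !mxE; exact: conjc_ge0.
pose y a := w ^+ a / w ^+ k.
(* The weights [p i] at the points [h 0 i] and the coefficients of [T] at the points [y b] have the
   same moments: both give the trace of F(w^a) times the Gram operator of X. *)
have key a : \sum_i p i * h 0 i ^+ a = \sum_(b < D.+1) T`_b * y b ^+ a.
  have -> : \sum_i p i * h 0 i ^+ a = \tr (efun F ((w ^+ a)%:M : 'M_n) *m (adjmx X *m X)).
    rewrite hP -!mulmxA mxtrace_mulC -!mulmxA mul_diag_mx /mxtrace.
    by apply: eq_bigr => i _; rewrite mxE [X in _ = X * _]mxE mulrC /p !mulmxA.
  have -> : adjmx X = \sum_j conjc (c j) *: efun F (adjmx (U j)).
    rewrite /X /adjmx raddf_sum /= raddf_sum /=; apply: eq_bigr => j _.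
    by rewrite map_mxZ linearZ /=; congr (_ *: _); rewrite efun_adj.
  rewrite mulmx_suml mulmx_sumr raddf_sum /=.
  transitivity ((w ^+ a ^+ k)^-1 * T.[w ^+ a]); last first.
    rewrite (horner_coef_wide _ sT) mulr_sumr; apply: eq_bigr => b _.
    rewrite /y expr_div_n -!exprM [(a * b)%N]mulnC [(a * k)%N]mulnC; ring.
  rewrite /T horner_sum mulr_sumr; apply: eq_bigr => j _.
  rewrite -scalemxAl -scalemxAr mxtraceZ horner_sum /X mulmx_sumr mulmx_sumr raddf_sum /=.
  rewrite mulr_sumr mulr_sumr; apply: eq_bigr => l _.
  rewrite -!scalemxAr mxtraceZ hornerZ.
  have uA := adjmx_unitary (uU j).
  rewrite -(efunM expF uA (uU l)) -efunM //; last 2 first.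
  - exact: scalar_unitary.
  - exact: mulmx_unitary.
  rewrite trS //; ring.
have keyq (q : {poly C}) : \sum_i p i * q.[h 0 i] = \sum_(b < D.+1) T`_b * q.[y b].
  transitivity (\sum_(a < size q) q`_a * \sum_i p i * h 0 i ^+ a).
    under [RHS]eq_bigr do rewrite mulr_sumr.
    rewrite exchange_big /=; apply: eq_bigr => i _.
    by rewrite horner_coef mulr_sumr; apply: eq_bigr => a _; ring.
  under eq_bigr do rewrite key mulr_sumr.
  rewrite exchange_big /=; apply: eq_bigr => i _.
  by rewrite horner_coef mulr_sumr; apply: eq_bigr => a _; ring.
(* A polynomial that is 1 at [y w0] and 0 at all other points involved isolates the coefficient of
   index w0 as a sum of some of the [p i]. *)
have [q qP] := poly_interpolation ([seq h 0 i | i : 'I_(edim F n)] ++ [seq y (b : nat) | b : 'I_D.+1])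
   (fun x => (x == y w0)%:R).
have := keyq q; rewrite (bigD1 (Ordinal w0D)) //= [X in _ + X]big1 ?addr0.
  rewrite qP ?mem_cat ?(image_f (fun b : 'I_D.+1 => y b) (x := Ordinal w0D)) ?orbT // eqxx mulr1 => <-.
  apply: sumr_ge0 => i _; rewrite qP; last by rewrite mem_cat image_f.
  by apply: mulr_ge0 => //; rewrite ler0n.
move=> b bw; rewrite qP ?mem_cat ?(image_f (fun b : 'I_D.+1 => y b)) ?orbT //.
have /negPf -> : y b != y w0; last by rewrite mulr0.
apply: contra bw => /eqP; rewrite /y => /divIf e; apply/eqP/val_inj => /=.
have wk : w ^+ k != 0 by rewrite expf_neq0.
have /eqP := e wk; rewrite (eq_prim_root_expr wP) /=.
by rewrite eqn_mod_dvd_le // || (rewrite !modn_small // => /eqP).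
Qed.

End Positivity.

(** * The trace polynomial of a unitary matrix *)

Section SpectralPolynomial.
Variables (R : realType) (F : expfun R) (m : nat) (P : {poly int}).
Local Notation C := (R[i]).
Hypothesis expF : is_exponential_functor F.
Hypothesis charF : character_is F m P.
Let PC : {poly C} := map_poly (fun c : int => c%:~R) P.

Lemma size_PC : size PC = size P.
Proof. by rewrite size_map_inj_poly ?mulr0z // => a b /intr_inj. Qed.

(** If the l_i are the eigenvalues of U, the trace of F(zU) is the product of the characters at z
    l_i, and S is the product of the l_i^-m P(l_i z). The bound is the triangle inequality with
    |l_i| = 1; the last clause regroups the linear factors by root instead of by eigenvalue. *)
Lemma trace_spectral_poly n (U : 'M[C]_n) : unitary U ->
  exists S : {poly C},
  [/\ (size S <= (n * (size P).-1).+1)%N,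
      (forall z, z * conjc z = 1 ->
        \tr (efun F (z%:M *m U)) = (z ^+ (m * n))^-1 * S.[z]),
      ((forall k, 0 <= PC`_k) -> forall x, 0 <= x -> `|S.[x]| <= PC.[x] ^+ n) &
      forall rs, PC = lead_coef PC *: \prod_(r <- rs) ('X - r%:P) -> forall z,
        S.[z] = (\det U)^-1 ^+ m * lead_coef PC ^+ n * \prod_(r <- rs) \det (z%:M *m U - r%:M)].
Proof.
move=> uU; have [V [l [uV l1 eU]]] := unitary_spectral uU.
have [v1 v2] := uV.
have zU z : z%:M *m U = adjmx V *m diag_mx (\row_i (z * l 0 i)) *m V.
  rewrite eU mul_scalar_mx scalemxAl scalemxAr; congr (_ *m _ *m _).
  by apply/matrixP=> i j; rewrite !mxE mulrnAr.
exists (\prod_i (l 0 i)^-1 ^+ m *: \prod_i (PC \Po (l 0 i *: 'X))); split.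
- apply: leq_trans (size_scale_leq _ _) _.
  apply: leq_trans (size_prod_leq _ _) _.
  rewrite cardT size_enum_ord -size_PC.
  have : (\sum_(i < n) size (PC \Po (l 0 i *: 'X))%R <= \sum_(i < n) (size PC).-1.+1)%N.
    apply: leq_sum => i _; apply: leq_trans (size_comp_poly_leq _ _) _; rewrite ltnS.
    rewrite -[X in (_ <= X)%N]muln1 leq_mul2l; apply/orP; right.
    have := @size_scale_leq _ (l 0 i) ('X : {poly C}); rewrite size_polyX.
    by case: (size _) => [|[|[]]].
  rewrite sum_nat_const card_ord mulnS.
  move: (bigop _ _ _) (n * _)%N => s d h; rewrite leq_subLR; apply: leq_trans (_ : (n + d).+1 <= _)%N => //; by rewrite addnS.
- move=> z z1; have uD : unitary (diag_mx (\row_i (z * l 0 i))).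
    by apply: diag_unitary => i; rewrite !mxE rmorphM mulrACA z1 l1 mulr1.
  have uA := adjmx_unitary uV.
  rewrite zU efunM // ?efunM //; last exact: mulmx_unitary.
  rewrite mxtrace_mulC mulmxA -efunM // v1 efun1 // mul1mx.
  rewrite efun_diag_trace //; last by move=> i; have := diag_unitaryP uD i.
  rewrite hornerZ horner_prod exprM -[n in X in _ = (_ ^+ X)^-1 * _]card_ord.
  rewrite -prodr_const -prodfV -!big_split /=; apply: eq_bigr => i _.
  rewrite mxE charF; last by rewrite rmorphM mulrACA z1 l1 mulr1.
  by rewrite -/PC horner_comp !hornerE [l 0 i * z]mulrC exprMn invfM exprVn /=; ring.
- move=> P0 x x0.
  have nl i : `|l 0 i| = 1.
    have := l1 i; rewrite -conjcE -normCK => /eqP.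
    by rewrite pexpr_eq1 // => /eqP.
  rewrite hornerZ horner_prod normrM !normr_prod.
  have -> : \prod_i `|(l 0 i)^-1 ^+ m| = 1.
    by apply: big1 => i _; rewrite normrX normfV nl invr1 expr1n.
  rewrite mul1r.
  rewrite -[n in X in _ <= X]card_ord -prodr_const; apply: ler_prod => i _.
  rewrite normr_ge0 /= horner_comp !hornerE !horner_coef.
  apply: le_trans (ler_norm_sum _ _ _) _; apply: ler_sum => k _.
  rewrite normrM normrX normrM nl mul1r (ger0_norm (P0 k)) (ger0_norm x0).
  exact: lexx.
- move=> rs ePC z.
  have detU : \det U = \prod_i l 0 i.
    by rewrite eU det_mulmx mulrC -det_mulmx mulmxA v1 mul1mx det_diag.
  have detz r : \det (z%:M *m U - r%:M) = \prod_i (z * l 0 i - r).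
    have -> : z%:M *m U - r%:M = adjmx V *m diag_mx (\row_i (z * l 0 i - r)) *m V.
      have -> : diag_mx (\row_i (z * l 0 i - r)) = diag_mx (\row_i (z * l 0 i)) - r%:M.
        by apply/matrixP=> i j; rewrite !mxE mulrnBl.
      by rewrite mulmxBr mulmxBl zU mul_mx_scalar -scalemxAl v2 scalemx1.
    rewrite det_mulmx mulrC -det_mulmx mulmxA v1 mul1mx det_diag.
    by apply: eq_bigr => i _; rewrite mxE.
  rewrite hornerZ horner_prod detU -prodfV -prodrXl -mulrA; congr (_ * _).
  under [X in _ = _ * X]eq_bigr do rewrite detz.
  rewrite exchange_big /= -[n in X in _ = X * _]card_ord -prodr_const -big_split /=.
  apply: eq_bigr => i _; rewrite horner_comp ePC !hornerE horner_prod lead_coefZ.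
  rewrite (monicP (monic_prod_XsubC _ _ _)) mulr1; congr (_ * _).
  by apply: eq_bigr => r _; rewrite !hornerE mulrC.
Qed.

(** Positivity for the single matrix 1 in U(1), whose Gram polynomial is [PC] itself. *)
Lemma PC_coef_ge0 k : 0 <= PC`_k.
Proof.
have u1 : unitary (1%:M : 'M[C]_1) by apply: scalar_unitary; rewrite rmorph1 mulr1.
have := @gram_coef_ge0 R F expF 1 unit (fun=> 1) (fun=> 1%:M) (fun _ _ => PC) (size PC) m
  (fun=> u1) _ _ k.
rewrite !(big_pred1 tt); try by case.
rewrite conjc1 mulr1 scale1r; apply.
  by move=> _ _; rewrite leqnSn.
move=> _ _ z z1; have [a1 a2] := u1.
by rewrite a2 mulmx1 charF.
Qed.

End SpectralPolynomial.

(** * Cycles as products of transpositions, and their characteristic determinants *)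

Section WordPerm.
Variables (n : nat).
Implicit Types (w : seq 'I_n.+1).

(* The product of the transpositions (0 j) for j in [w]; if [0 :: w] is
   duplicate-free, it is the cycle through [0 :: w]. *)
Definition wperm w : 'S_n.+1 := (\prod_(j <- w) tperm 0 j)%g.

Lemma wperm_cat w1 w2 : wperm (w1 ++ w2) = (wperm w1 * wperm w2)%g.
Proof. exact: big_cat. Qed.

Lemma wpermV w : ((wperm w)^-1)%g = wperm (rev w).
Proof.
elim: w => [|i w IHw]; first by rewrite /wperm !big_nil invg1.
rewrite rev_cons -cats1 wperm_cat -IHw /wperm big_cons big_seq1 invMg.
by rewrite tpermV.
Qed.

Lemma wperm_id w x : x \notin 0 :: w -> wperm w x = x.
Proof.
elim: w => [|i w IHw]; first by rewrite /wperm big_nil perm1.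
rewrite !inE !negb_or => /and3P[x0 xi xw].
by rewrite /wperm big_cons permM tpermD 1?eq_sym // IHw // !inE negb_or x0.
Qed.

(* For [r = size w] the default value [0] of [nth] closes the cycle. *)
Lemma wperm_nth w r : uniq (0 :: w) -> (r <= size w)%N ->
  wperm w (nth 0 (0 :: w) r) = nth 0 w r.
Proof.
elim: w r => [|i w IHw] r; first by case: r => //; rewrite /wperm big_nil perm1.
rewrite /= inE negb_or => /andP[/andP[i0 w0] /andP[iw uw]] rw.
have u0w : uniq (0 :: w) by rewrite /= w0.
rewrite /wperm big_cons permM -/(wperm w).
case: r rw => [|[|r]] rw /=.
- by rewrite tpermL wperm_id // inE negb_or eq_sym i0.
- by rewrite tpermR; apply: (IHw 0%N).
- have nw : nth 0 w r \in w by rewrite mem_nth.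
  rewrite tpermD; first exact: (IHw r.+1).
    by apply: contraNneq w0 => ->.
  by apply: contraNneq iw => ->.
Qed.

Lemma odd_wperm w : 0 \notin w -> odd_perm (wperm w) = odd (size w).
Proof.
elim: w => [|i w IHw]; first by rewrite /wperm big_nil odd_perm1.
rewrite inE negb_or => /andP[i0 w0].
by rewrite /wperm big_cons odd_permM odd_tperm i0 -/(wperm w) IHw.
Qed.

(** Once s follows the cycle at one point, injectivity forbids it to fix the next one, so it follows
    the cycle all the way round. *)
Lemma perm_along_wperm w (s : 'S_n.+1) : uniq (0 :: w) -> (0 < size w)%N ->
  (forall i, (s i == i) || (s i == wperm w i)) -> s = 1%g \/ s = wperm w.
Proof.
move=> u w0 sP.
have fixP x : wperm w x == x -> x \notin 0 :: w.
  apply: contraL => /(nthP 0)[r rw <-]; rewrite wperm_nth //.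
  rewrite -[nth 0 w r]/(nth 0 (0 :: w) r.+1).
  have [rw1|rw1] := ltnP r.+1 (size (0 :: w)); first by rewrite nth_uniq // gtn_eqF.
  rewrite [nth _ _ r.+1]nth_default // -[X in X == _]/(nth 0 (0 :: w) 0) nth_uniq //.
  by rewrite eq_sym -lt0n; exact: leq_trans w0 rw1.
have step x : x \in 0 :: w -> s x = wperm w x -> s (wperm w x) = wperm w (wperm w x).
  move=> xw sx; have /orP[/eqP e|/eqP//] := sP (wperm w x).
  have /perm_inj/eqP/fixP : s (wperm w x) = s x by rewrite e.
  by rewrite xw.
have stepn r : (r <= size w)%N -> s 0 = wperm w 0 -> s (nth 0 (0 :: w) r) = wperm w (nth 0 (0 :: w) r).
  elim: r => [|r IHr] rw //= s0.
  have rw' := ltnW rw.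
  by rewrite -[nth 0 w r](wperm_nth u rw') step // ?IHr // mem_nth.
have [s0|s0] := eqVneq (s 0) (wperm w 0).
  right; apply/permP => x; have [xw|xw] := boolP (x \in 0 :: w).
    by have [r rw <-] := nthP 0 xw; apply: stepn.
  by rewrite wperm_id //; have := sP x; rewrite wperm_id // orbb => /eqP.
left; apply/permP => x; rewrite perm1.
have /orP[/eqP//|/eqP sx] := sP x.
have [xw|xw] := boolP (x \in 0 :: w); last by rewrite sx wperm_id.
have [r rw e] := nthP 0 xw.
have : forall k, (r + k <= size w)%N -> s (nth 0 (0 :: w) (r + k)) = wperm w (nth 0 (0 :: w) (r + k)).
  elim=> [|k IHk] rk; first by rewrite addn0 e.
  have rk' : (r + k <= size w)%N by lia.
  by rewrite addnS /= -(wperm_nth u rk') step ?IHk // mem_nth.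
(* The cycle sends the last entry of [0 :: w] to 0, so s would follow the cycle at 0 as well. *)
move=> /(_ (size w - r)%N); rewrite subnKC // => /(_ (leqnn _)) e2.
have := step _ _ e2; rewrite wperm_nth // [nth 0 w _]nth_default // mem_nth // => /(_ isT).
by move/eqP; rewrite (negPf s0).
Qed.

(** In the Leibniz expansion only the identity and the cycle survive. Points of the cycle contribute
    -r to the former and z to the latter; each of the n - size w other points contributes z - r to
    both. *)
Lemma det_wperm (K : comPzRingType) w (z r : K) : uniq (0 :: w) ->
  \det (z%:M *m perm_mx (wperm w) - r%:M)
  = (-1) ^+ size w * (z ^+ (size w).+1 - r ^+ (size w).+1) * (z - r) ^+ (n - size w).
Proof.
move=> u.
have entry i j : (z%:M *m perm_mx (wperm w) - r%:M) i j
    = (if wperm w i == j then z else 0) - (if i == j then r else 0).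
  by rewrite mul_scalar_mx !mxE; case: (_ == j); case: (i == j); rewrite ?mulr1 ?mulr0 ?mulr1n ?mulr0n.
have cw : #|[set x in 0 :: w]| = (size w).+1 by rewrite cardsE; exact/card_uniqP.
have cw' : #|~: [set x in 0 :: w]| = (n - size w)%N by rewrite cardsCs setCK cw card_ord.
have splitp (f : 'I_n.+1 -> K) (a b : K) : (forall x, x \in 0 :: w -> f x = a) ->
   (forall x, x \notin 0 :: w -> f x = b) -> \prod_x f x = a ^+ (size w).+1 * b ^+ (n - size w).
  move=> fa fb; rewrite (bigID (fun x => x \in [set x in 0 :: w])) /=; congr (_ * _).
    by rewrite -cw -prodr_const; apply: eq_bigr => x; rewrite inE => /fa.
  rewrite -cw' -prodr_const; apply: eq_big => x; first by rewrite in_setC.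
  by rewrite inE => /fb.
(* For empty [w] the two surviving permutations coincide, so this case is computed directly. *)
have [w0|w0] := posnP (size w).
  have -> : w = [::] by case: (w) w0.
  have w1 : wperm [::] = 1%g by rewrite /wperm big_nil.
  rewrite w1 perm_mx1 mulmx1 -[z%:M - _]raddfB /= det_scalar expr0 mul1r subn0 !expr1.
  by rewrite exprS.
have nfix x : x \in 0 :: w -> wperm w x != x.
  move=> /(nthP 0)[k kw <-]; rewrite wperm_nth //.
  rewrite -[nth 0 w k]/(nth 0 (0 :: w) k.+1).
  have [rw1|rw1] := ltnP k.+1 (size (0 :: w)); first by rewrite nth_uniq // gtn_eqF.
  rewrite [nth _ _ k.+1]nth_default // -[X in X != _]/(nth 0 (0 :: w) 0) nth_uniq //.
  by rewrite eq_sym -lt0n; exact: leq_trans w0 rw1.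
have w1 : wperm w != 1%g.
  by apply/eqP=> w1; have := nfix 0 (mem_head _ _); rewrite w1 perm1 eqxx.
rewrite /determinant (bigD1 1%g) //= (bigD1 (wperm w)) //=. rewrite [X in _ + (_ + X)]big1 ?addr0 => [|s /andP[s1 sw]].
  rewrite odd_perm1 odd_wperm; last by case/andP: u.
  rewrite (splitp _ (- r) (z - r)); first rewrite (splitp _ z (z - r)).
  - by rewrite signr_odd (exprNn r) exprS; ring.
  - by move=> x xw; rewrite entry eqxx eq_sym (negPf (nfix _ xw)) subr0.
  - by move=> x xw; rewrite entry wperm_id // eqxx.
  - by move=> x xw; rewrite entry perm1 eqxx (negPf (nfix _ xw)) sub0r.
  - by move=> x xw; rewrite entry perm1 wperm_id // eqxx.
have [i si|sP] := pickP (fun i => ~~ ((s i == i) || (s i == wperm w i))).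
  move: si; rewrite negb_or => /andP[a b]; rewrite (bigD1 i) //= entry.
  by rewrite [i == _]eq_sym [_ == s i]eq_sym (negPf a) (negPf b) subrr mul0r mulr0.
have [e|e] := @perm_along_wperm w s u w0 (fun i => negbFE (sP i)).
  by rewrite e eqxx in s1.
by rewrite e eqxx in sw.
Qed.

Lemma det_perm_wperm (K : comPzRingType) w : 0 \notin w ->
  \det (perm_mx (wperm w) : 'M[K]_n.+1) = (-1) ^+ size w.
Proof. by move=> w0; rewrite det_perm odd_wperm // signr_odd. Qed.

End WordPerm.

(** * Hankel positivity and the roots of the character *)

Lemma sum_pairs_exchange (I J : finType) (V : nmodType) (G : I * J -> I * J -> V) :
  \sum_j \sum_l G j l = \sum_r \sum_r' \sum_a \sum_b G (r, a) (r', b).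
Proof.
transitivity (\sum_r \sum_a \sum_l G (r, a) l).
  by rewrite [RHS]pair_bigA /=; apply: eq_bigr => -[].
apply: eq_bigr => r _; rewrite [RHS]exchange_big; apply: eq_bigr => a _.
by rewrite [RHS]pair_bigA /=; apply: eq_bigr => -[].
Qed.

Section Roots.
Variables (R : realType) (F : expfun R) (m : nat) (P : {poly int}).
Local Notation C := (R[i]).
Hypothesis expF : is_exponential_functor F.
Hypothesis charF : character_is F m P.
Hypothesis P_neq0 : P != 0.
Let PC : {poly C} := map_poly (fun c : int => c%:~R) P.
Let L := lead_coef PC.
Variable (rs : seq C).
Hypothesis PCE : PC = L *: \prod_(r <- rs) ('X - r%:P).
Let eps : C := (-1) ^+ (m + size rs).

Lemma lead_PC_gt0 : 0 < L.
Proof.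
rewrite lt_neqAle eq_sym lead_coef_eq0 -size_poly_eq0 size_PC size_poly_eq0 P_neq0.
exact: PC_coef_ge0 expF charF _.
Qed.

Lemma horner_PC_gt0 x : 0 < x -> 0 < PC.[x].
Proof.
move=> x0; have s0 : (0 < size PC)%N by rewrite size_PC lt0n size_poly_eq0.
rewrite horner_coef -(prednK s0) big_ord_recr /= ltr_wpDl //.
  by apply: sumr_ge0 => i _; rewrite mulr_ge0 ?exprn_ge0 ?(ltW x0) // (PC_coef_ge0 expF charF).
by rewrite mulr_gt0 ?exprn_gt0 // lead_PC_gt0.
Qed.

(** The contribution of a k-cycle to the trace polynomial at x: its eigenvalues are the k-th roots
    of unity, so each root r of P yields x^k - r^k up to sign. The sign (-1)^(k-1) of the cycle
    enters once for each root and m times through the determinant. *)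
Definition cycle_trace (x : C) k : C :=
  eps ^+ k.-1 * L ^+ k * \prod_(r <- rs) (x ^+ k - r ^+ k).

(** Each of the n - size w fixed points contributes a factor P(x). *)
Lemma cycle_spectral_value (n : nat) (w : seq 'I_n.+1) (S : {poly C}) x :
  uniq (0 :: w) ->
  (forall z, S.[z] = (\det (perm_mx (wperm w) : 'M[C]_n.+1))^-1 ^+ m * L ^+ n.+1
     * \prod_(r <- rs) \det (z%:M *m perm_mx (wperm w) - r%:M)) ->
  S.[x] = cycle_trace x (size w).+1 * PC.[x] ^+ (n - size w).
Proof.
move=> u ->; have w0 : 0 \notin w by case/andP: u.
have wn : (size w <= n)%N by have := max_card (mem (0 :: w)); rewrite (card_uniqP u) card_ord.
under eq_bigr do rewrite det_wperm //.
rewrite !big_split /= det_perm_wperm // big_const_seq count_predT iter_mulr_1.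
rewrite /cycle_trace /= {1}PCE hornerZ horner_prod.
under [X in _ = _ * (_ * X) ^+ _]eq_bigr do rewrite hornerXsubC.
have -> : ((-1) ^+ size w : C)^-1 = (-1) ^+ size w by rewrite -exprVn invrN1.
rewrite exprMn -prodrXl /eps -!exprM.
have -> : L ^+ n.+1 = L ^+ (size w).+1 * L ^+ (n - size w) by rewrite -exprD addSn subnKC.
have -> : (-1) ^+ ((m + size rs) * size w) = (-1) ^+ (size w * m) * (-1) ^+ (size w * size rs) :> C.
  by rewrite -exprD; congr (_ ^+ _); lia.
ring.
Qed.

Section Hankel.
Variables (x : C) (K : nat) (q : 'I_K -> C).
Hypothesis x_gt0 : 0 < x.
Let y := PC.[x].
Let Lam := \sum_a \sum_b conjc (q a) * q b * cycle_trace x (a + b).+1.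
Let B := \sum_a \sum_b `|q a| * `|q b| * y ^+ (a + b).+1.

(* The [N * (N - 1)] pairs of distinct blocks each contribute [Lam]; [E] collects
   the [N] pairs of equal blocks. *)
Lemma hankel_block_bound N : (2 <= N)%N ->
  exists E : C, `|E| <= N%:R * B /\ 0 <= (N * N.-1)%:R * Lam + E.
Proof.
(* The n + 1 points are one common point 0 and N disjoint blocks of K points. *)
move=> N2; set n := (N * K)%N.
have y0 : 0 < y := horner_PC_gt0 x_gt0.
have yc : conjc y = y by rewrite -conjcE; apply/CrealP/gtr0_real.
(* The first a points of block r; the successor skips the common point 0. *)
pose wd (r : 'I_N) (a : nat) : seq 'I_n.+1 := [seq inord (r * K + c).+1 | c <- iota 0 a].
have swd r a : size (wd r a) = a by rewrite size_map size_iota.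
have wdP r (a : 'I_K) (j : 'I_n.+1) : j \in wd r a -> (r * K < j <= r * K + a)%N.
  move=> /mapP[c]; rewrite mem_iota add0n => /andP[_ ca] ->.
  have lt : ((r * K + c).+1 < n.+1)%N.
    rewrite ltnS /n; have := ltn_ord r; have := ltn_ord a => h1 h2.
    apply: (@leq_trans (r.+1 * K)); last by rewrite leq_mul2r h2 orbT.
    by rewrite mulSn; lia.
  by rewrite inordK //; lia.
have uwd r (a : 'I_K) : uniq (wd r a).
  rewrite map_inj_in_uniq ?iota_uniq // => c c'; rewrite !mem_iota !add0n => /andP[_ ca] /andP[_ ca'].
  move=> /(congr1 (@nat_of_ord _)); rewrite !inordK; first lia.
    rewrite ltnS /n; have := ltn_ord r; have := ltn_ord a => h1 h2.
    apply: (@leq_trans (r.+1 * K)); last by rewrite leq_mul2r h2 orbT.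
    by rewrite mulSn; lia.
  rewrite ltnS /n; have := ltn_ord r; have := ltn_ord a => h1 h2.
  apply: (@leq_trans (r.+1 * K)); last by rewrite leq_mul2r h2 orbT.
  by rewrite mulSn; lia.
have uw r r' (a b : 'I_K) : r != r' -> uniq (0 :: (rev (wd r a) ++ wd r' b)).
  move=> rr; rewrite cons_uniq mem_cat mem_rev cat_uniq rev_uniq !uwd /= andbT negb_or.
  have n0 r1 (a1 : 'I_K) : 0 \notin wd r1 a1 by apply/negP => /wdP.
  rewrite !n0 /=; apply/hasPn => j j1; rewrite mem_rev; apply/negP => /wdP j2.
  have {}j1 := wdP _ _ _ j1; have := ltn_ord a; have := ltn_ord b => hb ha.
  move/eqP: rr; apply; apply: val_inj => /=.
  have [h|h|//] := ltngtP r r'.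
    by have := leq_mul2r K r.+1 r'; rewrite h orbT mulSn; lia.
  by have := leq_mul2r K r'.+1 r; rewrite h orbT mulSn; lia.
pose U (j : 'I_N * 'I_K) : 'M[C]_n.+1 := perm_mx (wperm (wd j.1 j.2)).
(* For two different blocks, undoing one cycle and running the other gives a single cycle of length
   a + b + 1 through 0. *)
have UE j l : adjmx (U j) *m U l = perm_mx (wperm (rev (wd j.1 j.2) ++ wd l.1 l.2)).
  by rewrite wperm_cat perm_mxM -wpermV /adjmx /U map_perm_mx tr_perm_mx.
have adjU j : adjmx (U j) = perm_mx ((wperm (wd j.1 j.2))^-1)%g.
  by rewrite /adjmx /U map_perm_mx tr_perm_mx.
have uU j : unitary (U j).
  by split; rewrite adjU -perm_mxM ?mulgV ?mulVg perm_mx1.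
have uUU jl : unitary (adjmx (U jl.1) *m U jl.2).
  by apply: mulmx_unitary => //; apply: adjmx_unitary.
have [S SP] := fin_all_exists (fun jl => trace_spectral_poly expF charF (uUU jl)).
(* A cycle of length a + b + 1 leaves n - (a + b) fixed points, each worth y. The weights y^a and
   y^b compensate for this, so all pairs of distinct blocks acquire the same factor y^n. *)
pose c (j : 'I_N * 'I_K) := q j.2 * y ^+ j.2.
have := @gram_coef_ge0 R F expF n.+1 _ c U (fun j l => S (j, l)) (n.+1 * (size P).-1) (m * n.+1) uU.
move=> /(_ (fun j l => let: And4 h _ _ _ := SP (j, l) in h)).
move=> /(_ (fun j l => let: And4 _ h _ _ := SP (j, l) in h)).
set T := \sum_j _ => T0.
have {T0} : 0 <= T.[x].
  by rewrite horner_coef; apply: sumr_ge0 => i _; rewrite mulr_ge0 // exprn_ge0 // ltW.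
have -> : T.[x] = \sum_(r < N) \sum_(r' < N) \sum_a \sum_b
     conjc (q a) * q b * y ^+ (a + b) * (S ((r, a), (r', b))).[x].
  rewrite -(sum_pairs_exchange (fun j l => conjc (q j.2) * q l.2 * y ^+ (j.2 + l.2) * (S (j, l)).[x])).
  rewrite /T horner_sum; apply: eq_bigr => j _; rewrite horner_sum; apply: eq_bigr => l _.
  rewrite hornerZ /c rmorphM rmorphXn /= yc exprD; ring.
(* Pairs inside block r, for which the crude bound |S(x)| <= y^(n+1) suffices. *)
pose D r := \sum_a \sum_b conjc (q a) * q b * y ^+ (a + b) * (S ((r, a), (r, b))).[x].
have -> : \sum_(r < N) \sum_(r' < N) \sum_a \sum_b
     conjc (q a) * q b * y ^+ (a + b) * (S ((r, a), (r', b))).[x]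
   = y ^+ n * ((N * N.-1)%:R * Lam + \sum_r D r / y ^+ n).
  have yn : y ^+ n != 0 by rewrite expf_neq0 // gt_eqF.
  have -> : y ^+ n * ((N * N.-1)%:R * Lam + \sum_r D r / y ^+ n) = \sum_(r < N) (y ^+ n * (N.-1%:R * Lam) + D r).
    by rewrite big_split /= sumr_const card_ord -mulr_suml natrM -[_ *+ N]mulr_natl; field.
  apply: eq_bigr => r _; rewrite (bigD1 r) //= addrC; congr (_ + _).
  have -> : N.-1%:R * Lam = \sum_(r' < N | r' != r) Lam.
    by rewrite sumr_const cardC1 card_ord mulr_natl.
  rewrite mulr_sumr; apply: eq_bigr => r' rr; rewrite mulr_sumr; apply: eq_bigr => a _.
  rewrite mulr_sumr; apply: eq_bigr => b _.
  have [_ _ _ /(_ rs PCE)] := SP ((r, a), (r', b)); rewrite /= UE => Sv.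
  have u := uw r r' a b; rewrite eq_sym in rr.
  rewrite (cycle_spectral_value _ (u rr) Sv) size_cat size_rev !swd.
  have abn : (a + b <= n)%N.
    by have := max_card (mem (0 :: (rev (wd r a) ++ wd r' b))); rewrite (card_uniqP (u rr)) card_ord /= size_cat size_rev !swd.
  have -> : y ^+ n = y ^+ (a + b) * y ^+ (n - (a + b)) by rewrite -exprD subnKC.
  rewrite -/y; ring.
rewrite pmulr_rge0 ?exprn_gt0 // => H.
exists (\sum_r D r / y ^+ n); split => //.
apply: le_trans (ler_norm_sum _ _ _) _.
rewrite mulr_natl -[X in _ *+ X]card_ord -sumr_const; apply: ler_sum => r _.
rewrite normrM normfV (ger0_norm (exprn_ge0 n (ltW y0))) ler_pdivrMr ?exprn_gt0 //.
rewrite /B mulr_suml; apply: le_trans (ler_norm_sum _ _ _) _; apply: ler_sum => a _.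
rewrite mulr_suml; apply: le_trans (ler_norm_sum _ _ _) _; apply: ler_sum => b _.
rewrite !normrM -conjcE norm_conjC -!mulrA ler_wpM2l // ler_wpM2l //.
rewrite (ger0_norm (exprn_ge0 _ (ltW y0))) exprSr -mulrA ler_wpM2l ?(exprn_ge0 _ (ltW y0)) // -exprS.
have [_ _ h _] := SP ((r, a), (r, b)). apply: h; last exact: ltW.
exact: PC_coef_ge0 expF charF.
Qed.

(** After division by N, the term in [Lam] grows with N while the error stays bounded. The order on
    complex numbers is partial, so negativity is excluded instead of nonnegativity being
    asserted. *)
Lemma hankel_not_lt0 : ~~ (Lam < 0).
Proof.
apply/negP => L0.
have B0 : 0 <= B.
  by apply: sumr_ge0 => a _; apply: sumr_ge0 => b _; rewrite !mulr_ge0 // exprn_ge0 // ltW // horner_PC_gt0.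
have key N : N.+1%:R * - Lam <= B.
  have [E [E1 E2]] := @hankel_block_bound N.+2 isT.
  have LE : (N.+2 * N.+1)%:R * - Lam <= E.
    by rewrite mulrN -subr_ge0 opprK addrC.
  have /ger0_norm EE : 0 <= E by apply: le_trans LE; rewrite mulr_ge0 // oppr_ge0 ltW.
  have := le_trans LE (le_trans (_ : E <= `|E|) E1); rewrite EE lexx => /(_ isT).
  by rewrite natrM -mulrA ler_pM2l.
(* The Archimedean bound is taken on real parts. *)
have l0 : 0 < complex.Re (- Lam) by move: L0; rewrite -oppr_gt0 ltcE => /andP[_].
have [N NP] : exists N : nat, complex.Re B / complex.Re (- Lam) < N.+1%:R.
  exists (Num.bound (complex.Re B / complex.Re (- Lam))).
  have h : 0 <= complex.Re B / complex.Re (- Lam).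
    by rewrite divr_ge0 ?(ltW l0) //; move: B0; rewrite lecE => /andP[].
  by apply: lt_trans (archi_boundP h) _; rewrite ltr_nat.
have := key N; rewrite lecE => /andP[_]; apply/negP; rewrite -ltNge.
rewrite mulr_natl raddfMn /= -mulr_natl.
by rewrite -ltr_pdivrMr.
Qed.

End Hankel.

End Roots.

Lemma prod_const_but1 (K : numFieldType) (I : finType) (f : I -> K) (i0 : I) (x a : K) :
  f i0 = a -> (forall i, i != i0 -> f i = x) -> \prod_i f i = a * x ^+ #|I|.-1.
Proof.
move=> fa fx; rewrite (bigD1 i0) //= fa; congr (_ * _).
by rewrite (eq_bigr (fun=> x)) ?prodr_const ?cardC1.
Qed.

(* Only singletons [S] give the modulus of order [x ^ (d - 1)]. *)
Lemma subset_prod_norm (K : numFieldType) (I : finType) (rho : I -> K) (i0 : I)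
    (M x : K) (S : {set I}) :
  (forall i, `|rho i| <= M) -> 1 <= M -> rho i0 != 0 ->
  M < x -> M ^+ 2 < `|rho i0| * x ->
  `|\prod_i (if i \in S then rho i else x)| = `|\prod_i (if i \in [set i0] then rho i else x)| ->
  exists i, S = [set i].
Proof.
move=> rhoM M1 r0 Mx M2.
have M0 : 0 < M by apply: lt_le_trans M1.
have x0 : 0 < x by apply: lt_trans Mx.
have nx : `|x| = x by rewrite gtr0_norm.
have r00 : 0 < `|rho i0| by rewrite normr_gt0.
have -> : `|\prod_i (if i \in [set i0] then rho i else x)| = `|rho i0| * x ^+ #|I|.-1.
  rewrite normr_prod; apply: (prod_const_but1 (i0 := i0)) => [|i]; rewrite inE ?eqxx //.
  by move=> /negPf ->.
rewrite normr_prod.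
have fle i : 0 <= `|if i \in S then rho i else x| <= x.
  rewrite normr_ge0; case: ifP => _; rewrite ?nx ?lexx //.
  exact: le_trans (rhoM i) (ltW Mx).
have I0 : (0 < #|I|)%N by apply/card_gt0P; exists i0.
(* For empty S, equality of the moduli would give x = |rho i0| <= M < x. *)
have [->|[i iS]] := set_0Vmem S.
  have -> : \prod_i `|if i \in set0 then rho i else x| = x * x ^+ #|I|.-1.
    by apply: (prod_const_but1 (i0 := i0)) => [|i _]; rewrite inE nx.
  move=> e; have {}e : x = `|rho i0| by apply: (mulIf _ e); rewrite expf_neq0 // gt_eqF.
  by have := le_lt_trans (rhoM i0) Mx; rewrite -e ltxx.
have [->|nS] := eqVneq S [set i]; first by exists i.
have [j jS ji] : exists2 j, j \in S & j != i.
  apply/exists_inP; apply: contraR nS; rewrite negb_exists_in => /forall_inP h.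
  apply/eqP/setP => j; rewrite inE; apply/idP/eqP => [|->//].
  by move=> /h; rewrite negbK => /eqP.
(* Two elements of S replace two factors x by at most M^2, which is less than |rho i0| x. *)
move=> e; suff : \prod_i `|if i \in S then rho i else x| < `|rho i0| * x ^+ #|I|.-1 by rewrite e ltxx.
have cI : (#|I|.-1 = (#|[pred k | (k != i) && (k != j)]|).+1)%N.
  have := cardC1 i; rewrite (cardD1 j) inE ji => <-.
  by congr (_.+1); apply: eq_card => k; rewrite !inE andbC.
rewrite (bigD1 i) //= (bigD1 j) //= iS jS cI exprS !mulrA.
apply: (@le_lt_trans _ _ (M ^+ 2 * x ^+ #|[pred k | (k != i) && (k != j)]|)).
  rewrite expr2; apply: ler_pM.
  - by rewrite mulr_ge0.
  - by apply: prodr_ge0 => k _; apply: normr_ge0.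
  - exact: ler_pM.
  - by rewrite -prodr_const; apply: ler_prod => k _.
by rewrite ltr_pM2r // exprn_gt0.
Qed.

(** * The roots of the character are real and nonpositive *)

Section NonpositiveRoots.
Variables (R : realType) (F : expfun R) (m : nat) (P : {poly int}).
Local Notation C := (R[i]).
Hypothesis expF : is_exponential_functor F.
Hypothesis charF : character_is F m P.
Hypothesis P_neq0 : P != 0.
Let PC : {poly C} := map_poly (fun c : int => c%:~R) P.
Let L := lead_coef PC.

(** A nonzero root z violating the claim would allow a polynomial q with negative Hankel form,
    concentrated on the exponential attached to the singleton of z and on its conjugate. *)
Theorem character_root_le0 (z : C) : root PC z -> z <= 0.
Proof.
have [rs PCE] := closed_field_poly_normal PC.
have L0 : 0 < L := lead_PC_gt0 expF charF P_neq0.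
rewrite PCE rootZ ?gt_eqF // root_prod_XsubC => /(nthP 0)[k0 k0s zE].
pose d := size rs; pose rho (i : 'I_d) := rs`_i; pose i0 : 'I_d := Ordinal k0s.
have z0 : z = rho i0 by rewrite -zE.
have [->//|znz] := eqVneq z 0.
pose M := 1 + \sum_i `|rho i|.
have M1 : 1 <= M by rewrite lerDl sumr_ge0.
have M0 : 0 < M by apply: lt_le_trans M1.
have rhoM i : `|rho i| <= M.
  rewrite /M (bigD1 i) //= addrCA lerDl addr_ge0 ?sumr_ge0 //.
have nz : 0 < `|z| by rewrite normr_gt0.
(* Chosen so that M < x and M^2 < |z| x, the two bounds that isolate the singletons by modulus. *)
pose x := 1 + M + M ^+ 2 / `|z|.
have q0 : 0 < M ^+ 2 / `|z| by rewrite divr_gt0 // exprn_gt0.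
have x0 : 0 < x by rewrite /x; apply: addr_gt0 => //; apply: addr_gt0.
have Mx : M < x by rewrite /x addrAC ltrDr; apply: addr_gt0.
have M2x : M ^+ 2 < `|z| * x.
  by rewrite /x mulrDr mulrCA mulfV ?gt_eqF // mulr1 ltrDr; apply: mulr_gt0 => //; apply: addr_gt0.
pose eps : C := (-1) ^+ (m + size rs).
have eps2 : eps * eps = 1 by rewrite -expr2 sqrr_sign.
have epsc : conjc eps = eps by rewrite rmorphXn rmorphN1.
(* Expanding the product over the roots turns the cycle traces into an exponential sum with bases
   [xS S]. *)
pose xS (S : {set 'I_d}) : C := eps * L * \prod_i (if i \in S then rho i else x).
have cycE k : cycle_trace m P rs x k.+1 = \sum_(S : {set 'I_d}) eps * (-1) ^+ #|S| * xS S ^+ k.+1.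
  rewrite /cycle_trace (big_nth 0) big_mkord /=.
  under eq_bigr do rewrite addrC.
  rewrite bigA_distr mulr_sumr; apply: eq_bigr => S _.
  have -> : \prod_i (if i \in S then - rs`_i ^+ k.+1 else x ^+ k.+1)
     = (-1) ^+ #|S| * (\prod_(i : 'I_d) (if i \in S then rho i else x)) ^+ k.+1.
    have -> : (-1) ^+ #|S| = \prod_(i : 'I_d) (if i \in S then -1 else 1) :> C by rewrite -big_mkcond prodr_const.
    rewrite -prodrXl -big_split /=; apply: eq_bigr => i _.
    by case: ifP => _; rewrite ?mulN1r ?mul1r.
  rewrite /xS -/eps !exprMn -/PC -/L [eps ^+ k.+1]exprS.
  transitivity ((eps * eps) * (eps ^+ k * L ^+ k.+1 *
    ((-1) ^+ #|S| * (\prod_i (if i \in S then rho i else x)) ^+ k.+1))); last by ring.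
  by rewrite eps2 mul1r.
pose y0 := xS [set i0].
(* Up to a positive factor this is -z, so its nonnegativity becomes the goal. *)
have y0E : - (eps * y0) = (- z) * (L * x ^+ d.-1).
  rewrite /y0 /xS (prod_const_but1 (i0 := i0) (x := x) (a := z)).
  - rewrite card_ord !mulrA eps2; ring.
  - by rewrite inE eqxx -z0.
  - by move=> i; rewrite inE => /negPf ->.
have y0nz : y0 != 0.
  apply/eqP => y00; move: y0E; rewrite y00 mulr0 oppr0 => /esym/eqP.
  by rewrite mulf_eq0 oppr_eq0 (negPf znz) /= mulf_eq0 expf_eq0 !gt_eqF // andbF.
have xS1 S : `|xS S| = `|y0| -> exists i, S = [set i].
  rewrite /y0 /xS !normrM => h; apply: (subset_prod_norm (rho := rho) (i0 := i0) (M := M) (x := x)).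
  - exact: rhoM.
  - exact: M1.
  - by rewrite -z0.
  - exact: Mx.
  - by rewrite -z0.
  - by apply: mulfI h; rewrite mulf_eq0 !normr_eq0 signr_eq0 gt_eqF.
rewrite -oppr_ge0 -(pmulr_lge0 (x := L * x ^+ d.-1)); last by rewrite mulr_gt0 // exprn_gt0.
rewrite -y0E; apply: contraT => neg.
(* If y0 is not real, the value at its conjugate makes every term with base y0 or its conjugate
   equal to -1. If y0 is real, the terms with base y0 equal [- (eps * y0)], which is negative by
   assumption. All other terms vanish. *)
pose g (y : C) := if y == y0 then 1
  else if y == conjc y0 then conjc (eps / y0) else 0.
have [q qP] := poly_interpolation
  ([seq xS T | T : {set 'I_d}] ++ [seq conjc (xS T) | T : {set 'I_d}]) g.
have qx S : q.[xS S] = g (xS S) by apply: qP; rewrite mem_cat image_f.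
have qxc S : q.[conjc (xS S)] = g (conjc (xS S)).
  by apply: qP; rewrite mem_cat (image_f (fun S => conjc (xS S))) ?orbT.
pose t (S : {set 'I_d}) := eps * (-1) ^+ #|S| * xS S * (conjc (q.[conjc (xS S)]) * q.[xS S]).
have := @hankel_not_lt0 R F m P expF charF P_neq0 rs PCE x (size q) (fun i => q`_i) x0.
have -> : \sum_(a < size q) \sum_(b < size q) conjc q`_a * q`_b * cycle_trace m P rs x (a + b).+1
   = \sum_(S : {set 'I_d}) t S.
  transitivity (\sum_(a < size q) \sum_(b < size q) \sum_(S : {set 'I_d})
      (eps * (-1) ^+ #|S| * xS S) * ((conjc q`_a * xS S ^+ a) * (q`_b * xS S ^+ b))).
    apply: eq_bigr => a _; apply: eq_bigr => b _; rewrite cycE mulr_sumr; apply: eq_bigr => S _.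
    by rewrite exprS exprD; ring.
  under eq_bigr do rewrite exchange_big.
  rewrite exchange_big /=; apply: eq_bigr => S _.
  rewrite /t !horner_coef rmorph_sum /= mulr_suml mulr_sumr; apply: eq_bigr => a _.
  rewrite -mulr_sumr -mulr_sumr rmorphM rmorphXn /= conjcK; ring.
(* By [xS1], the bases y0 and its conjugate come from singletons only, so the signs (-1)^|S| agree
   and nothing cancels. *)
suff tS S : t S <= 0 /\ (S = [set i0] -> t S < 0).
  move/negP; case; rewrite (bigD1 [set i0]) //=.
  apply: le_lt_trans (_ : t [set i0] < 0); last by case: (tS [set i0]) => _; apply.
  by rewrite gerDl sumr_le0 // => S _; case: (tS S).
have g1 : g y0 = 1 by rewrite /g eqxx.
rewrite /t qx qxc.
have [yr|ync] := eqVneq (conjc y0) y0.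
  have yreal : eps * y0 \is Num.real by rewrite CrealE conjcE rmorphM /= epsc yr.
  have neg' : - (eps * y0) < 0 by rewrite real_ltNge ?rpredN // real0.
  have [e|ne] := eqVneq (xS S) y0.
    have [i Si] := xS1 S (congr1 _ e).
    by rewrite e yr g1 Si cards1 conjc1 !mulr1 expr1 mulrN1 mulNr; split=> [|_ //]; apply: ltW.
  have -> : g (xS S) = 0 by rewrite /g (negPf ne) yr (negPf ne).
  by rewrite !mulr0; split => // SE; rewrite SE eqxx in ne.
have gc : g (conjc y0) = conjc (eps / y0) by rewrite /g (negPf ync) eqxx.
have [e|ne] := eqVneq (xS S) y0.
  have [i Si] := xS1 S (congr1 _ e).
  have -> : eps * (-1) ^+ #|S| * xS S * (conjc (g (conjc (xS S))) * g (xS S)) = - (eps * eps).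
    by rewrite e g1 gc conjcK Si cards1; field.
  by rewrite eps2 lerN10 ltrN10.
have [e|nec] := eqVneq (xS S) (conjc y0).
  have [|i Si] := xS1 S; first by rewrite e -conjcE norm_conjC.
  have -> : eps * (-1) ^+ #|S| * xS S * (conjc (g (conjc (xS S))) * g (xS S)) = - conjc (eps * eps).
    have ce : conjc (eps / y0) = eps / conjc y0 by rewrite rmorphM fmorphV /= epsc.
    rewrite e conjcK g1 gc ce conjc1 Si cards1 eps2 conjc1 -[RHS](congr1 -%R eps2).
    by have := y0nz; rewrite -(conjc_eq0 y0) => h; field.
  by rewrite eps2 conjc1 lerN10 ltrN10.
have -> : g (xS S) = 0 by rewrite /g (negPf ne) (negPf nec).
by rewrite !mulr0; split => // SE; rewrite SE eqxx in ne.
Qed.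

End NonpositiveRoots.

(** * Substitution of the variables and the localized ring *)

HB.instance Definition _ := GRing.isZmodMorphism.Build Tpol Kfr tof
  (@tofrac_is_zmod_morphism Tpol).
HB.instance Definition _ := GRing.isMonoidMorphism.Build Tpol Kfr tof
  (@tofrac_is_monoid_morphism Tpol).

Lemma tof_eq0 q : (tof q == 0) = (q == 0).
Proof. exact: tofrac_eq0. Qed.

Lemma tofD p q : tof (p + q) = tof p + tof q.
Proof. exact: rmorphD. Qed.

Lemma tofB p q : tof (p - q) = tof p - tof q.
Proof. exact: rmorphB. Qed.

Lemma tofM p q : tof (p * q) = tof p * tof q.
Proof. exact: rmorphM. Qed.

Lemma tofXn p k : tof (p ^+ k) = tof p ^+ k.
Proof. exact: rmorphXn. Qed.

Lemma tof_inj : injective tof.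
Proof. by move=> p q /eqP; rewrite tofrac_eq => /eqP. Qed.

Definition tofc (c : rat) : Kfr := tof c%:P%:P.

HB.instance Definition _ := GRing.RMorphism.copy tofc (tof \o polyC \o polyC).

Lemma tofc_ratr c : tofc c = ratr c.
Proof. exact: fmorph_eq_rat. Qed.

Lemma fracE (x : Kfr) :
  x = tof (frac (generic_quotient.repr x)).1 / tof (frac (generic_quotient.repr x)).2.
Proof.
set r := generic_quotient.repr x.
have d0 : tof (frac r).2 != 0 by rewrite tof_eq0 denom_ratioP.
apply: (mulIf d0); rewrite mulfVK // -[X in X * _](generic_quotient.reprK x) -/r /tof.
unlock FracField.tofrac; rewrite -[LHS]FracField.pi_mul; apply/generic_quotient.eqmodP => /=.
rewrite FracField.equivfE /FracField.mulf /= !numden_Ratio ?oner_eq0 ?mulf_neq0 ?denom_ratioP ?mulr1 //.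
- by rewrite mulrC.
- exact: oner_neq0.
- exact: oner_neq0.
Qed.

(** [evT] as a composite of bundled ring morphisms, from which it inherits its morphism
    structure. *)
Definition evTr (s1 s2 : Kfr) : Tpol -> Kfr :=
  horner_eval s1 \o map_poly (horner_eval s2 \o map_poly tofc).

HB.instance Definition _ s1 s2 := GRing.RMorphism.copy (evTr s1 s2)
  (horner_eval s1 \o map_poly (horner_eval s2 \o map_poly tofc)).

Lemma evTrD s1 s2 p q : evTr s1 s2 (p + q) = evTr s1 s2 p + evTr s1 s2 q.
Proof. exact: rmorphD. Qed.

Lemma evTrB s1 s2 p q : evTr s1 s2 (p - q) = evTr s1 s2 p - evTr s1 s2 q.
Proof. exact: rmorphB. Qed.

Lemma evTrM s1 s2 p q : evTr s1 s2 (p * q) = evTr s1 s2 p * evTr s1 s2 q.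
Proof. exact: rmorphM. Qed.

Lemma evTrXn s1 s2 p k : evTr s1 s2 (p ^+ k) = evTr s1 s2 p ^+ k.
Proof. exact: rmorphXn. Qed.

Lemma evTE s1 s2 q : evT s1 s2 q = evTr s1 s2 q.
Proof.
rewrite /evT /evTr /= /horner_eval; congr (_.[_]).
apply: eq_map_poly => c /=; congr (_.[_]).
by apply: eq_map_poly => r; rewrite tofc_ratr.
Qed.

Lemma evTrC s1 s2 c : evTr s1 s2 c%:P%:P = tofc c.
Proof. by rewrite /evTr /= map_polyC /= map_polyC /horner_eval !hornerC. Qed.

Lemma evTrX s1 s2 : evTr s1 s2 'X = s1.
Proof. by rewrite /evTr /= map_polyX /horner_eval hornerX. Qed.

Lemma evTrY s1 s2 : evTr s1 s2 ('X)%:P = s2.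
Proof. by rewrite /evTr /= map_polyC /= map_polyX /horner_eval hornerC hornerX. Qed.

Lemma Tpol_ind (Q : Tpol -> Prop) :
  (forall c : rat, Q c%:P%:P) -> Q 'X -> Q ('X)%:P ->
  (forall p q, Q p -> Q q -> Q (p + q)) -> (forall p q, Q p -> Q q -> Q (p * q)) ->
  forall q, Q q.
Proof.
move=> QC QX QY QD QM.
have QP (p : {poly rat}) : Q p%:P.
  elim/poly_ind: p => [|p c IHp]; first exact: QC 0.
  by rewrite rmorphD rmorphM /=; apply: QD => //; apply: QM.
elim/poly_ind => [|p c IHp]; first exact: QC 0.
by apply: QD => //; apply: QM.
Qed.

Lemma evTr_id q : evTr t1 t2 q = tof q.
Proof.
elim/Tpol_ind: q => [c|||p q IHp IHq|p q IHp IHq].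
- by rewrite evTrC.
- by rewrite evTrX.
- by rewrite evTrY.
- by rewrite evTrD tofD IHp IHq.
- by rewrite evTrM tofM IHp IHq.
Qed.

Lemma t1_neq0 : t1 != 0.
Proof. by rewrite /t1 tof_eq0 polyX_eq0. Qed.

Lemma t2_neq0 : t2 != 0.
Proof. by rewrite /t2 tof_eq0 polyC_eq0 polyX_eq0. Qed.

Lemma ord3P (Q : 'I_3 -> Prop) : Q 0 -> Q 1 -> Q 2 -> forall i, Q i.
Proof.
move=> Q0 Q1 Q2; case=> -[|[|[|//]]] h.
- by rewrite (_ : Ordinal h = 0) //; apply: val_inj.
- by rewrite (_ : Ordinal h = 1) //; apply: val_inj.
- by rewrite (_ : Ordinal h = 2) //; apply: val_inj.
Qed.

Lemma big_ord3 (T : Type) (idx : T) (op : Monoid.law idx) (f : 'I_3 -> T) :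
  \big[op/idx]_i f i = op (op (f 0) (f 1)) (f 2).
Proof.
rewrite !big_ord_recr big_ord0 Monoid.mul1m.
by congr (op (op (f _) (f _)) (f _)); apply: val_inj.
Qed.

Lemma tvar0 : tvar 0 = t1. Proof. by []. Qed.
Lemma tvar1 : tvar 1 = t2. Proof. by []. Qed.
Lemma tvar2 : tvar 2 = (t1 * t2)^-1. Proof. by []. Qed.

Lemma t1t2_neq0 : t1 * t2 != 0.
Proof. exact: mulf_neq0 t1_neq0 t2_neq0. Qed.

Lemma tvar_neq0 i : tvar i != 0.
Proof.
elim/ord3P: i; first exact: t1_neq0; first exact: t2_neq0.
exact: invr_neq0 t1t2_neq0.
Qed.

Lemma prod_tvar : \prod_i tvar i = 1.
Proof. by rewrite big_ord3 tvar0 tvar1 tvar2; exact: mulfV t1t2_neq0. Qed.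

Lemma prod_tvar_perm (w : 'S_3) : tvar (w 0) * tvar (w 1) * tvar (w 2) = 1.
Proof.
by rewrite -prod_tvar (reindex_perm w) big_ord3.
Qed.

Notation evP w := (evTr (tvar (w 0)) (tvar (w 1))).

(* The graph of the substitution [t_i |-> t_(v i)] on Laurent polynomials. *)
Definition laurent_subst (v : 'S_3) (x y : Kfr) : Prop :=
  exists (k : nat) (q : Tpol),
    x * (t1 * t2) ^+ k = tof q /\ y * (tvar (v 0) * tvar (v 1)) ^+ k = evP v q.

Lemma laurent_subst_tvar v i : laurent_subst v (tvar i) (tvar (v i)).
Proof.
elim/ord3P: i.
- by exists 0%N, 'X; rewrite !expr0 !mulr1 evTrX.
- by exists 0%N, ('X)%:P; rewrite !expr0 !mulr1 evTrY.
- exists 1%N, 1; rewrite !expr1 !rmorph1 tvar2; split; first exact: mulVf t1t2_neq0.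
  by rewrite -(prod_tvar_perm v) mulrC.
Qed.

Lemma tof_t1t2 k : (t1 * t2) ^+ k = tof (('X * ('X)%:P) ^+ k).
Proof. by rewrite tofXn tofM. Qed.

Lemma evP_t1t2 (v : 'S_3) k :
  (tvar (v 0) * tvar (v 1)) ^+ k = evP v (('X * ('X)%:P) ^+ k).
Proof. by rewrite evTrXn evTrM evTrX evTrY. Qed.

Lemma laurent_substD v x y x' y' : laurent_subst v x y -> laurent_subst v x' y' ->
  laurent_subst v (x + x') (y + y').
Proof.
move=> [k [q [e1 e2]]] [k' [q' [e1' e2']]].
exists (k + k')%N, (q * ('X * ('X)%:P) ^+ k' + q' * ('X * ('X)%:P) ^+ k).
rewrite !(tofD, evTrD, tofM, evTrM) -!tof_t1t2 -!evP_t1t2 -e1 -e2 -e1' -e2' !exprD.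
by split; ring.
Qed.

Lemma laurent_substM v x y x' y' : laurent_subst v x y -> laurent_subst v x' y' ->
  laurent_subst v (x * x') (y * y').
Proof.
move=> [k [q [e1 e2]]] [k' [q' [e1' e2']]].
exists (k + k')%N, (q * q').
rewrite !(tofM, evTrM) -e1 -e2 -e1' -e2' !exprD.
by split; ring.
Qed.

(** The relation is compatible with sums and products, so it suffices to compose the substitutions
    on generators. *)
Lemma laurent_subst_evP (v w : 'S_3) q : laurent_subst v (evP w q) (evP (w * v)%g q).
Proof.
elim/Tpol_ind: q => [c|||p q IHp IHq|p q IHp IHq].
- by exists 0%N, c%:P%:P; rewrite !expr0 !mulr1 !evTrC.
- by rewrite !evTrX permM; apply: laurent_subst_tvar.
- by rewrite !evTrY permM; apply: laurent_subst_tvar.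
- by rewrite !evTrD; apply: laurent_substD.
- by rewrite !evTrM; apply: laurent_substM.
Qed.

(** Substituting by w^-1 afterwards recovers q, so the substitution is injective. *)
Lemma evP_eq0 (w : 'S_3) q : (evP w q == 0) = (q == 0).
Proof.
apply/eqP/eqP => [q0|->]; last by rewrite rmorph0.
have [k [p [e1 e2]]] := laurent_subst_evP w^-1%g w q.
move: e1; rewrite q0 mul0r => /esym/eqP; rewrite tof_eq0 => /eqP p0.
have n0 : (tvar (w^-1%g 0) * tvar (w^-1%g 1)) ^+ k != 0.
  exact: expf_neq0 (mulf_neq0 (tvar_neq0 _) (tvar_neq0 _)).
move: e2; rewrite p0 rmorph0 mulgV !perm1 evTr_id => /eqP.
by rewrite mulf_eq0 (negPf n0) orbF tof_eq0 => /eqP.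
Qed.

(** Injectivity keeps denominators nonzero, so the representative chosen in [sigmaW] does not
    matter. *)
Lemma sigmaW_frac w n d : d != 0 -> sigmaW w (tof n / tof d) = evP w n / evP w d.
Proof.
move=> d0; rewrite /sigmaW !evTE.
set x := tof n / tof d; have := fracE x; set r := frac _ => e.
have r0 : r.2 != 0 by rewrite denom_ratioP.
have /tof_inj e' : tof (r.1 * d) = tof (n * r.2).
  rewrite !tofM; move/eqP: e; rewrite /x eqr_div ?tof_eq0 // => /eqP ->.
  by rewrite mulrC.
apply/eqP; rewrite eqr_div ?evP_eq0 // -!evTrM e'; exact: eqxx.
Qed.

Lemma frac_ind (Q : Kfr -> Prop) :
  (forall n d, d != 0 -> Q (tof n / tof d)) -> forall x, Q x.
Proof. by move=> QF x; rewrite (fracE x); apply: QF; rewrite denom_ratioP. Qed.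

Lemma subf_div (K : fieldType) (a b c d : K) : b != 0 -> d != 0 ->
  a / b - c / d = (a * d - c * b) / (b * d).
Proof. by move=> b0 d0; field; rewrite b0 d0. Qed.

Lemma sigmaW_zmod w : zmod_morphism (sigmaW w).
Proof.
move=> x y; elim/frac_ind: x => n d d0; elim/frac_ind: y => n' d' d0'.
have e0 q : q != 0 -> evP w q != 0 by rewrite evP_eq0.
have f0 q : q != 0 -> tof q != 0 by rewrite tof_eq0.
rewrite (subf_div _ _ (f0 _ d0) (f0 _ d0')) -!tofM -tofB.
rewrite !sigmaW_frac //; last exact: mulf_neq0.
by rewrite (subf_div _ _ (e0 _ d0) (e0 _ d0')) -!evTrM -evTrB.
Qed.

Lemma sigmaW_monoid w : monoid_morphism (sigmaW w).
Proof.
split=> [|x y].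
  by rewrite -[1]divr1 -(rmorph1 tof) sigmaW_frac ?oner_eq0 // !rmorph1 divr1.
elim/frac_ind: x => n d d0; elim/frac_ind: y => n' d' d0'.
rewrite mulf_div -!tofM !sigmaW_frac //; last exact: mulf_neq0.
by rewrite mulf_div -!evTrM.
Qed.

HB.instance Definition _ w := GRing.isZmodMorphism.Build Kfr Kfr (sigmaW w) (sigmaW_zmod w).
HB.instance Definition _ w := GRing.isMonoidMorphism.Build Kfr Kfr (sigmaW w) (sigmaW_monoid w).

Lemma sigmaWM w x y : sigmaW w (x * y) = sigmaW w x * sigmaW w y.
Proof. exact: rmorphM. Qed.

Lemma sigmaWN w x : sigmaW w (- x) = - sigmaW w x.
Proof. exact: rmorphN. Qed.

Lemma sigmaWV w x : sigmaW w x^-1 = (sigmaW w x)^-1.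
Proof. exact: fmorphV. Qed.

Lemma sigmaWXn w x k : sigmaW w (x ^+ k) = sigmaW w x ^+ k.
Proof. exact: rmorphXn. Qed.

Lemma sigmaW_tof w q : sigmaW w (tof q) = evP w q.
Proof. by rewrite -[tof q]divr1 -(rmorph1 tof) sigmaW_frac ?oner_eq0 // rmorph1 divr1. Qed.

Lemma sigmaW_tvar w i : sigmaW w (tvar i) = tvar (w i).
Proof.
have s0 : sigmaW w t1 = tvar (w 0) by rewrite sigmaW_tof evTrX.
have s1 : sigmaW w t2 = tvar (w 1) by rewrite sigmaW_tof evTrY.
elim/ord3P: i => //.
rewrite tvar2 sigmaWV sigmaWM s0 s1.
have n0 : tvar (w 0) * tvar (w 1) != 0 := mulf_neq0 (tvar_neq0 _) (tvar_neq0 _).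
by apply: (mulfI n0); rewrite (mulfV n0) -(prod_tvar_perm w).
Qed.

Lemma sigmaW_Ft m P w i : sigmaW w (Ft m P i) = Ft m P (w i).
Proof.
rewrite /Ft /pev sigmaWM sigmaWV sigmaWXn sigmaW_tvar; congr (_ * _).
transitivity ((map_poly (sigmaW w) (map_poly (fun c : int => c%:~R) P)).[sigmaW w (tvar i)]).
  exact: esym (horner_map _ _ _).
rewrite sigmaW_tvar -map_poly_comp; congr (_.[_]).
by apply: eq_map_poly => c; exact: rmorph_int.
Qed.

Definition laurent (x : Kfr) : Prop := exists k q, x * (t1 * t2) ^+ k = tof q.

Lemma laurent_tof q : laurent (tof q).
Proof. by exists 0%N, q; rewrite expr0 mulr1. Qed.

Lemma laurentD x y : laurent x -> laurent y -> laurent (x + y).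
Proof.
move=> [k [q e]] [k' [q' e']].
exists (k + k')%N, (q * ('X * ('X)%:P) ^+ k' + q' * ('X * ('X)%:P) ^+ k).
by rewrite tofD !tofM -!tof_t1t2 -e -e' exprD; ring.
Qed.

Lemma laurentM x y : laurent x -> laurent y -> laurent (x * y).
Proof.
move=> [k [q e]] [k' [q' e']]; exists (k + k')%N, (q * q').
by rewrite tofM -e -e' exprD; ring.
Qed.

Lemma laurentX x k : laurent x -> laurent (x ^+ k).
Proof.
move=> lx; elim: k => [|k IHk]; last by rewrite exprS; apply: laurentM.
by rewrite expr0 -(rmorph1 tof); apply: laurent_tof.
Qed.

Lemma laurent_tofc c : laurent (tofc c).
Proof. exact: laurent_tof. Qed.

Lemma laurent_tvar i : laurent (tvar i).
Proof. by have [k [q [e _]]] := laurent_subst_tvar 1%g i; exists k, q. Qed.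

(** As t1 t2 t3 = 1, the inverse of one variable is the product of the other two. *)
Lemma laurent_tvarV i : laurent (tvar i)^-1.
Proof.
have := prod_tvar; rewrite (bigD1 i isT) => e0.
have e : \prod_(j | true && (j != i)) tvar j = (tvar i)^-1.
  by apply: (mulfI (tvar_neq0 i)); rewrite (mulfV (tvar_neq0 i)).
rewrite -e; elim/big_rec: _ => [|j x _ lx]; first by rewrite -(rmorph1 tof); apply: laurent_tof.
by apply: laurentM => //; apply: laurent_tvar.
Qed.

Lemma laurent_horner (p : {poly rat}) x : laurent x -> laurent (map_poly tofc p).[x].
Proof.
move=> lx; elim/poly_ind: p => [|p c IHp].
  by rewrite rmorph0 horner0 -(rmorph0 tof); apply: laurent_tof.
rewrite rmorphD rmorphM /= map_polyX map_polyC hornerMXaddC.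
by apply: laurentD (laurent_tofc c); apply: laurentM.
Qed.

Lemma map_intr_tofc (P : {poly int}) :
  map_poly (fun c : int => c%:~R) P = map_poly tofc (map_poly intr P) :> {poly Kfr}.
Proof.
rewrite -map_poly_comp; apply: eq_map_poly => c /=; by rewrite rmorph_int.
Qed.

Lemma horner_t1 (p : {poly rat}) : (map_poly tofc p).[t1] = tof (map_poly polyC p).
Proof.
have -> : map_poly tofc p = map_poly tof (map_poly polyC (map_poly polyC p)).
  by rewrite -!map_poly_comp; apply: eq_map_poly.
by rewrite /t1 horner_map /= -/(comp_poly _ _) comp_polyXr.
Qed.

Lemma horner_t2 (p : {poly rat}) : (map_poly tofc p).[t2] = tof p%:P.
Proof.
have -> : map_poly tofc p = map_poly (tof \o polyC) (map_poly polyC p).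
  by rewrite -!map_poly_comp; apply: eq_map_poly.
rewrite /t2 -[tof 'X%:P]/((tof \o polyC) 'X) horner_map /= -/(comp_poly _ _).
by rewrite comp_polyXr.
Qed.

(** * The localized ring and the Weyl action on it *)

Section LocalizedRing.
Variables (m : nat) (P : {poly int}).
Hypothesis P_neq0 : P != 0.
Local Notation Fi i := (Ft m P i).
Local Notation A := (inRF m P).

Lemma Ft_neq0 i : Fi i != 0.
Proof.
have F0 : Fi 0 != 0.
  apply: mulf_neq0; first exact: invr_neq0 (expf_neq0 _ (tvar_neq0 _)).
  rewrite map_intr_tofc tvar0 horner_t1 tof_eq0 map_poly_eq0.
  rewrite -size_poly_eq0 size_map_inj_poly ?size_poly_eq0 //.
  exact: intr_inj.
have -> : Fi i = sigmaW (tperm 0 i) (Fi 0) by rewrite sigmaW_Ft tpermL.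
by rewrite fmorph_eq0.
Qed.

Lemma laurent_Ft i : laurent (Fi i).
Proof.
rewrite /Ft /pev -exprVn map_intr_tofc; apply: laurentM.
  by apply: laurentX; apply: laurent_tvarV.
by apply: laurent_horner; apply: laurent_tvar.
Qed.

Lemma Fprod_neq0 : Fprod m P != 0.
Proof. exact: mulf_neq0 (mulf_neq0 (Ft_neq0 _) (Ft_neq0 _)) (Ft_neq0 _). Qed.

Lemma laurent_Fprod : laurent (Fprod m P).
Proof. exact: laurentM (laurentM (laurent_Ft 0) (laurent_Ft 1)) (laurent_Ft 2). Qed.

Lemma FprodE : Fprod m P = \prod_i Fi i.
Proof.
by rewrite big_ord3.
Qed.

Lemma inRFP x : A x <-> exists n, laurent (x * Fprod m P ^+ n).
Proof.
split=> [[q [k [n e]]]|[n [k [q e]]]]; first by exists n, k, q; rewrite mulrAC.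
by exists q, k, n; rewrite mulrAC.
Qed.

Lemma inRF_laurent x : laurent x -> A x.
Proof. by move=> lx; apply/inRFP; exists 0%N; rewrite expr0 mulr1. Qed.

(** Larger exponents also clear the denominator, so finitely many elements admit a common one. *)
Lemma inRF_laurent_pow x : A x -> exists n0, forall n, (n0 <= n)%N -> laurent (x * Fprod m P ^+ n).
Proof.
move=> /inRFP[n0 l0]; exists n0 => n nn.
rewrite -(subnKC nn) exprD mulrA; apply: laurentM => //.
by apply: laurentX; apply: laurent_Fprod.
Qed.

Lemma inRFD x y : A x -> A y -> A (x + y).
Proof.
move=> /inRF_laurent_pow[n nP] /inRF_laurent_pow[n' nP'].
apply/inRFP; exists (n + n')%N; rewrite mulrDl; apply: laurentD.
  by apply: nP; rewrite leq_addr.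
by apply: nP'; rewrite leq_addl.
Qed.

Lemma inRFM x y : A x -> A y -> A (x * y).
Proof.
move=> /inRFP[n l] /inRFP[n' l']; apply/inRFP; exists (n + n')%N.
by rewrite exprD mulrACA; apply: laurentM.
Qed.

Lemma inRF_tofc c : A (tofc c).
Proof. by apply: inRF_laurent; apply: laurent_tofc. Qed.

Lemma inRF1 : A 1.
Proof. by rewrite -(rmorph1 tofc); apply: inRF_tofc. Qed.

Lemma inRF0 : A 0.
Proof. by rewrite -(rmorph0 tofc); apply: inRF_tofc. Qed.

Lemma inRFN x : A x -> A (- x).
Proof. by move=> Ax; rewrite -mulN1r -(rmorphN1 tofc); apply: inRFM => //; apply: inRF_tofc. Qed.

Lemma inRFB x y : A x -> A y -> A (x - y).
Proof. by move=> Ax Ay; apply: inRFD => //; apply: inRFN. Qed.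

Lemma inRF_sign k : A ((-1) ^+ k).
Proof. by rewrite -signr_odd; case: odd; rewrite ?expr1 ?expr0; [apply: inRFN|]; apply: inRF1. Qed.

Lemma inRF_sum (I : Type) (r : seq I) (Q : pred I) (f : I -> Kfr) :
  (forall i, Q i -> A (f i)) -> A (\sum_(i <- r | Q i) f i).
Proof.
move=> Af; elim/big_ind: _ => //; first exact: inRF0.
exact: inRFD.
Qed.

Lemma inRF_prod (I : Type) (r : seq I) (Q : pred I) (f : I -> Kfr) :
  (forall i, Q i -> A (f i)) -> A (\prod_(i <- r | Q i) f i).
Proof.
move=> Af; elim/big_ind: _ => //; first exact: inRF1.
exact: inRFM.
Qed.

Lemma inRF_Ft i : A (Fi i).
Proof. by apply: inRF_laurent; apply: laurent_Ft. Qed.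

Lemma inRF_Fprod : A (Fprod m P).
Proof. by apply: inRF_laurent; apply: laurent_Fprod. Qed.

(** Multiplying the inverse by [Fprod] leaves the product of the two other characters. *)
Lemma inRF_FtV i : A (Fi i)^-1.
Proof.
apply/inRFP; exists 1%N; rewrite expr1 FprodE (bigD1 i) //= (mulKf (Ft_neq0 i)).
elim/big_ind: _ => [|x y|j _]; first by rewrite -(rmorph1 tof); apply: laurent_tof.
  exact: laurentM.
exact: laurent_Ft.
Qed.

Lemma inRF_Ft_exp i (z : int) : A (Fi i ^ z).
Proof.
have AX x k : A x -> A (x ^+ k).
  by move=> Ax; elim: k => [|k IHk]; [exact: inRF1 | rewrite exprS; apply: inRFM].
case: z => k; first by rewrite -exprnP; apply: AX; apply: inRF_Ft.
by rewrite NegzE -exprnN -exprVn; apply: AX; apply: inRF_FtV.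
Qed.

Lemma sigmaW_Fprod w : sigmaW w (Fprod m P) = Fprod m P.
Proof.
rewrite FprodE rmorph_prod [RHS](reindex_perm w); apply: eq_bigr => i _ /=.
exact: sigmaW_Ft.
Qed.

(** [Fprod] is invariant and inverses of variables go to inverses of variables, so the admissible
    denominators are preserved. *)
Lemma inRF_sigmaW w x : A x -> A (sigmaW w x).
Proof.
move=> /inRFP[n [k [q e]]]; apply/inRFP; exists n.
have := congr1 (sigmaW w) e; rewrite 2!sigmaWM !sigmaWXn sigmaW_Fprod sigmaW_tof => e'.
have n0 : sigmaW w (t1 * t2) != 0 by rewrite fmorph_eq0 t1t2_neq0.
have {e'} -> : sigmaW w x * Fprod m P ^+ n = evTr (tvar (w 0)) (tvar (w 1)) q * ((sigmaW w (t1 * t2))^-1) ^+ k.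
  by rewrite -e' exprVn mulrAC (mulfK (expf_neq0 k n0)).
apply: laurentM.
  by have [k' [q' [? _]]] := laurent_subst_evP 1%g w q; exists k', q'.
apply: laurentX; rewrite sigmaWM invfM; apply: laurentM.
  by rewrite -tvar0 sigmaW_tvar; apply: laurent_tvarV.
by rewrite -tvar1 sigmaW_tvar; apply: laurent_tvarV.
Qed.

End LocalizedRing.

(** * Regularity of the sequence F(t2) - F(t1), F(t3) - F(t2) *)

Lemma trig_tens (S : comPzRingType) n p (A : 'M[S]_n) (B : 'M[S]_p) :
  is_trig_mx A -> is_trig_mx B -> is_trig_mx (tensmx A B).
Proof.
move=> /is_trig_mxP tA /is_trig_mxP tB; apply/is_trig_mxP => i j.
case: (mxtens_indexP i) => i1 i2; case: (mxtens_indexP j) => j1 j2.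
rewrite tensmxE /= => lt.
have [h|h|h] := ltngtP i1 j1.
- by rewrite tA ?mul0r.
- have := ltn_ord j2; have : (j1.+1 * p <= i1 * p)%N by rewrite leq_mul2r h orbT.
  by rewrite mulSn; lia.
- by rewrite tB ?mulr0 //; move: lt; rewrite h; lia.
Qed.

Lemma tens1 (S : comPzRingType) n p :
  tensmx (1%:M : 'M[S]_n) (1%:M : 'M[S]_p) = 1%:M.
Proof.
apply/matrixP => i j; case: (mxtens_indexP i) => i1 i2; case: (mxtens_indexP j) => j1 j2.
rewrite tensmxE !mxE (can_eq (@mxtens_indexK _ _)) xpair_eqE.
by case: (i1 == j1); case: (i2 == j2); rewrite ?mulr1n ?mulr0n ?mulr1 ?mulr0.
Qed.

Lemma tensZ (S : comPzRingType) n p q r (a b : S) (A : 'M[S]_(n, p)) (B : 'M[S]_(q, r)) :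
  tensmx (a *: A) (b *: B) = (a * b) *: tensmx A B.
Proof.
apply/matrixP => i j; case: (mxtens_indexP i) => i1 i2; case: (mxtens_indexP j) => j1 j2.
by rewrite [RHS]mxE !tensmxE !mxE; ring.
Qed.

Lemma tens3M (S : comPzRingType) n1 n2 n3 p1 p2 p3 q1 q2 q3
  (A : 'M[S]_(n1, p1)) (B : 'M[S]_(n2, p2)) (C : 'M[S]_(n3, p3))
  (A' : 'M[S]_(p1, q1)) (B' : 'M[S]_(p2, q2)) (C' : 'M[S]_(p3, q3)) :
  tens3 A B C *m tens3 A' B' C' = tens3 (A *m A') (B *m B') (C *m C').
Proof. by rewrite !tensmx_mul. Qed.

Lemma tens3_sub1E (S : comPzRingType) n (A B C : 'M[S]_n) (i j k i' j' k' : 'I_n) :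
  (tens3 A B C - 1%:M) (mxtens_index (mxtens_index (i, j), k))
     (mxtens_index (mxtens_index (i', j'), k'))
  = A i i' * B j j' * C k k' - ([&& i == i', j == j' & k == k'])%:R.
Proof.
rewrite mxE !tensmxE; congr (_ + _); rewrite !mxE.
by rewrite !(can_eq (@mxtens_indexK _ _), xpair_eqE) -andbA.
Qed.

(** Triangularizing T makes the matrix triangular with diagonal entries abc - 1, for eigenvalues a,
    b, c of T. A product of three nonpositive numbers is nonpositive, hence not 1. *)
Lemma det_tens3_sub1_neq0 (K : numClosedFieldType) n (T : 'M[K]_n) :
  (forall z, root (char_poly T) z -> z <= 0) ->
  \det (tens3 T T T - 1%:M) != 0.
Proof.
move=> rT; have [] := @spectral.cotrigonalization K n [:: T].
  by move=> A B; rewrite !inE => /eqP -> /eqP ->.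
move=> V uV /andP[tV _]; have V1 := spectral.unitarymx_unit uV.
pose D := V *m T *m invmx V.
have tD : is_trig_mx D by rewrite /D -conjumx.
have TE : T = invmx V *m D *m V by rewrite /D !mulmxA mulVmx // mul1mx -mulmxA mulVmx // mulmx1.
move: D tD TE => D tD TE.
have rD i : D i i <= 0.
  apply: rT; have -> : char_poly T = char_poly D.
    rewrite TE /char_poly /char_poly_mx !map_mxM /=.
    have VV : map_mx polyC (invmx V) *m map_mx polyC V = 1%:M by rewrite -map_mxM mulVmx // map_mx1.
    have -> : 'X%:M - map_mx polyC (invmx V) *m map_mx polyC D *m map_mx polyC V
       = map_mx polyC (invmx V) *m ('X%:M - map_mx polyC D) *m map_mx polyC V.
      by rewrite mulmxBr mulmxBl mul_mx_scalar -scalemxAl VV scalemx1.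
    by rewrite !det_mulmx mulrAC -det_mulmx VV det1 mul1r.
  rewrite char_poly_trig // (bigD1 i) //= rootM root_XsubC eqxx //.
pose V3 := tens3 V V V; pose W3 := tens3 (invmx V) (invmx V) (invmx V).
have WV : W3 *m V3 = 1%:M by rewrite /W3 /V3 tens3M mulVmx // !tens1.
have -> : tens3 T T T - 1%:M = W3 *m (tens3 D D D - 1%:M) *m V3.
  rewrite mulmxBr mulmxBl mulmx1 WV; congr (_ - _).
  by rewrite /W3 /V3 !tens3M -TE.
rewrite !det_mulmx mulrAC -det_mulmx WV det1 mul1r.
have tD3 : is_trig_mx (tens3 D D D - 1%:M).
  have /is_trig_mxP t3 := trig_tens (trig_tens tD tD) tD.
  by apply/is_trig_mxP => i j ij; rewrite mxE t3 // !mxE -val_eqE ltn_eqF // subrr.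
rewrite det_trig //; apply/prodf_neq0 => i _.
case: (mxtens_indexP i) => ij k; case: (mxtens_indexP ij) => {}i j.
rewrite tens3_sub1E !eqxx subr_eq0.
apply/eqP => e; have : D i i * D j j * D k k <= 0.
  by rewrite mulr_ge0_le0 // mulr_le0.
by rewrite e => /le_lt_trans /(_ ltr01); rewrite ltxx.
Qed.

(** * Companion matrices and the resultant polynomial *)

Section Companion.
Variables (P : {poly int}) (m : nat).
Hypothesis mP : (m < (size P).-1)%N.
Let Pq : {poly rat} := map_poly intr P.
Let L : rat := lead_coef Pq.
Let p : {poly rat} := L^-1 *: Pq.

Let sPq : size Pq = size P.
Proof. by rewrite size_map_inj_poly ?mulr0z // => a b /intr_inj. Qed.

Let L_neq0 : L != 0.
Proof. by rewrite lead_coef_eq0 -size_poly_eq0 sPq; case: (size P) mP. Qed.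

Let p_monic : p \is monic.
Proof. by rewrite monicE lead_coefZ mulVf. Qed.

Let sp : size p = size P.
Proof. by rewrite size_scale ?invr_eq0. Qed.

Local Notation d := (size p).-1.

Let E : 'M[rat]_d := \matrix_(i, j) if (i == d.-1 :> nat) && (j == m :> nat) then L^-1 else 0.

(** The companion matrix of P - f X^m made monic, written as a pencil in f: as m < deg P, only the
    entry in the last row and column m depends on f. *)
Definition pencil (S : comPzRingType) (phi : rat -> S) (f : S) : 'M[S]_d :=
  map_mx phi (companionmx p) + f *: map_mx phi E.

Lemma pencilE (S : comPzRingType) (phi : rat -> S) f i j :
  pencil phi f i j = phi (if (i == d.-1 :> nat) then - p`_j else (i.+1 == j :> nat)%:R)
    + f * phi (if (i == d.-1 :> nat) && (j == m :> nat) then L^-1 else 0).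
Proof. by rewrite /pencil !mxE. Qed.

(** The upper rows shift the powers of x; the last row is the equation P(x) = f x^m solved for
    x^d. *)
Lemma pencil_eigenvector (K : fieldType) (phi : {rmorphism rat -> K}) (f x : K) :
  (map_poly phi Pq).[x] = f * x ^+ m ->
  pencil phi f *m (\col_(j < d) x ^+ j) = x *: (\col_(j < d) x ^+ j).
Proof.
move=> Px; apply/colP => i; rewrite !mxE.
have md : (m < d)%N by rewrite sp.
have d0 : (0 < d)%N by apply: leq_ltn_trans md.
have [id|id] := eqVneq (i : nat) d.-1.
  have -> : \sum_j pencil phi f i j * (\col_(j < d) x ^+ j) j 0
     = - \sum_(j < d) phi p`_j * x ^+ j + f * phi L^-1 * x ^+ m.
    rewrite -sumrN -(big_mkord xpredT (fun j => - (phi p`_j * x ^+ j))).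
    rewrite (eq_bigr (fun j : 'I_d => - (phi p`_j * x ^+ j)
        + f * phi (if (j == m :> nat) then L^-1 else 0) * x ^+ j)).
      2: by move=> j _; rewrite pencilE id eqxx mxE rmorphN mulrDl mulNr.
    rewrite big_split /= -(big_mkord xpredT (fun j => - (phi p`_j * x ^+ j))); congr (_ + _).
    rewrite (bigD1 (Ordinal md)) //= eqxx big1 ?addr0 // => j jm.
    by rewrite -[_ == m]/(j == Ordinal md) (negPf jm) rmorph0 mulr0 mul0r.
  have pE : (map_poly phi p).[x] = \sum_(j < d) phi p`_j * x ^+ j + x ^+ d.
    rewrite (@horner_coef_wide _ d.+1); last first.
      by rewrite size_map_poly; case: (size p).
    rewrite big_ord_recr /=; congr (_ + _).
      by apply: eq_bigr => j _; rewrite coef_map.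
    by rewrite coef_map /= -/(lead_coef p) (monicP p_monic) rmorph1 mul1r.
  have pE' : (map_poly phi p).[x] = phi L^-1 * (f * x ^+ m).
    by rewrite /p map_polyZ hornerZ Px.
  have -> : x * x ^+ i = x ^+ d by rewrite id -exprS prednK.
  have -> : x ^+ d = phi L^-1 * (f * x ^+ m) - \sum_(j < d) phi p`_j * x ^+ j.
    by rewrite -pE' pE addrC addKr.
  ring.
have id' : (i.+1 < d)%N by have := ltn_ord i; lia.
rewrite (bigD1 (Ordinal id')) //= big1 ?addr0.
  by rewrite pencilE mxE (negPf id) eqxx rmorph1 rmorph0 mulr0 addr0 mul1r exprS.
move=> j ji; rewrite pencilE mxE (negPf id) eq_sym -[_ == i.+1]/(j == Ordinal id') (negPf ji).
by rewrite !rmorph0 mulr0 addr0 mul0r.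
Qed.

(** The tensor product of the three eigenvectors has eigenvalue x0 x1 x2 = 1, so it lies in the
    kernel. *)
Lemma det_pencil_eq0 (K : fieldType) (phi : {rmorphism rat -> K}) (f x : 'I_3 -> K) :
  (forall i, (map_poly phi Pq).[x i] = f i * x i ^+ m) -> x 0 * x 1 * x 2 = 1 ->
  \det (tens3 (pencil phi (f 0)) (pencil phi (f 1)) (pencil phi (f 2)) - 1%:M) = 0.
Proof.
move=> Px x1; set M := tens3 _ _ _ - _.
pose v i := \col_(j < d) x i ^+ j.
pose v3 := tens3 (v 0) (v 1) (v 2).
have Mv : M *m v3 = 0.
  rewrite mulmxBl mul1mx /v3 tens3M !pencil_eigenvector // !tensZ x1 scale1r.
  exact: subrr.
have d0 : (0 < d)%N by rewrite sp; apply: leq_ltn_trans mP.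
pose o := Ordinal d0.
(* The adjugate shows that the determinant kills the kernel vector, whose entry with all exponents 0
   is 1. *)
have := congr1 (mulmx (\adj M)) Mv; rewrite mulmxA mul_adj_mx mulmx0 mul_scalar_mx.
move=> /matrixP /(_ (mxtens_index (mxtens_index (o, o), o)) (mxtens_index (mxtens_index (0, 0), 0))).
by rewrite [LHS]mxE [RHS]mxE /v3 !tensmxE !mxE !expr0 !mulr1.
Qed.

(** Over an algebraically closed field it vanishes at f exactly when three roots of P - f X^m,
    repetitions allowed, have product 1. *)
Definition resultant_poly : {poly rat} :=
  \det (tens3 (pencil polyC 'X) (pencil polyC 'X) (pencil polyC 'X) - 1%:M).

Lemma horner_resultant (K : fieldType) (phi : {rmorphism rat -> K}) f :
  (map_poly phi resultant_poly).[f]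
  = \det (tens3 (pencil phi f) (pencil phi f) (pencil phi f) - 1%:M).
Proof.
pose ev : {rmorphism {poly rat} -> K} := horner_eval f \o map_poly phi.
have evE q : ev q = (map_poly phi q).[f] by [].
rewrite -evE -det_map_mx; congr (\det _).
rewrite map_mxB map_mx1; congr (_ - _).
have e : map_mx ev (pencil polyC 'X) = pencil phi f.
  apply/matrixP => i j; rewrite mxE !pencilE evE rmorphD hornerD rmorphM hornerM /=.
  by rewrite map_polyX hornerX !map_polyC !hornerC.
by rewrite !map_mxT !e.
Qed.

(** At f = 0 the pencil is the companion matrix of P made monic, whose eigenvalues are
    nonpositive. *)
Lemma resultant_poly_neq0 (K : numClosedFieldType) :
  (forall z : K, root (map_poly intr P) z -> z <= 0) -> resultant_poly != 0.
Proof.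
move=> rP; apply/eqP => N0.
have := horner_resultant (ratr : {rmorphism rat -> K}) 0.
rewrite N0 rmorph0 horner0 => /esym/eqP; apply/negP.
have -> : pencil (ratr : rat -> K) 0 = map_mx ratr (companionmx p) by rewrite /pencil scale0r addr0.
apply: det_tens3_sub1_neq0 => z; rewrite -map_char_poly companionmxK //.
rewrite /p map_polyZ rootZ ?fmorph_eq0 ?invr_eq0 // => rz; apply: rP.
move: rz; rewrite /Pq -map_poly_comp; congr (is_true (root _ z)).
by apply: eq_map_poly => c /=; rewrite ratr_int.
Qed.

End Companion.

(* [m < deg P] keeps the term of highest degree from cancelling. *)
Lemma cleared_comp_poly (P N : {poly rat}) (m : nat) :
  (m < (size P).-1)%N -> N != 0 ->
  exists2 r : {poly rat}, r != 0 & forall (K : fieldType) (phi : {rmorphism rat -> K}) (x : K),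
    x != 0 -> (map_poly phi N).[(x ^+ m)^-1 * (map_poly phi P).[x]] * x ^+ (m * (size N).-1)
      = (map_poly phi r).[x].
Proof.
move=> mP N0; set e := (size N).-1; have sN : size N = e.+1 by rewrite prednK // size_poly_gt0.
have P0 : P != 0 by apply: contraTneq mP => ->; rewrite size_poly0.
(* This is X^(m e) N(P / X^m). The term j = e has degree e deg P, the others at most j deg P + m (e
   - j). *)
exists (\sum_(j < e.+1) N`_j *: (P ^+ j * 'X^(m * (e - j)))).
  rewrite big_ord_recr /= subnn muln0 expr0 mulr1 -size_poly_eq0.
  have Ne : N`_e != 0 by rewrite -[N`_e]/(lead_coef N) lead_coef_eq0.
  have sPe : size (P ^+ e) = ((size P).-1 * e).+1.
    by rewrite -(size_exp P e) prednK // size_poly_gt0 expf_neq0.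
  rewrite addrC size_polyDl ?size_scale // ?sPe //.
  rewrite ltnS; apply: leq_trans (size_sum _ _ _) _; apply/bigmax_leqP => j _.
  apply: leq_trans (size_scale_leq _ _) _; apply: leq_trans (size_polyMleq _ _) _.
  rewrite size_polyXn addnS /=.
  have : (size (P ^+ j) <= ((size P).-1 * j).+1)%N.
    by rewrite -(size_exp P j) leqSpred.
  have : (m * (e - j) < (size P).-1 * (e - j))%N.
    by rewrite ltn_pmul2r // subn_gt0.
  have : ((size P).-1 * e = (size P).-1 * j + (size P).-1 * (e - j))%N.
    by rewrite -mulnDr subnKC // ltnW.
  move: (size (P ^+ j)) (m * _)%N ((size P).-1 * j)%N ((size P).-1 * (e - j))%N => a b c d'.
  by move=> ->; lia.
move=> K phi x x0; rewrite (@horner_coef_wide _ e.+1); last first.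
  by rewrite size_map_poly sN.
rewrite mulr_suml raddf_sum horner_sum; apply: eq_bigr => j _ /=.
rewrite map_polyZ hornerZ coef_map rmorphM hornerM !rmorphXn /= map_polyX !horner_exp hornerX.
rewrite exprMn exprVn -exprM.
have -> : (m * e = m * j + m * (e - j))%N by rewrite -mulnDr subnKC // -ltnS.
have xj : x ^+ (m * j) != 0 by rewrite expf_neq0.
by rewrite exprD; field.
Qed.

(** * Elements of the fraction field that multiply the ideal into R_F *)

Section Regularity.
Variables (m : nat) (P : {poly int}).
Hypothesis mP : (m < (size P).-1)%N.
Variable (C : numClosedFieldType).
Hypothesis rootP : forall z : C, root (map_poly intr P) z -> z <= 0.
Local Notation Fi i := (Ft m P i).
Local Notation A := (inRF m P).

Let P_neq0 : P != 0.
Proof. by apply: contraTneq mP => ->; rewrite size_poly0. Qed.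

Section Congruence.
Variable c : Kfr.

(* The ideal of all [x] in R_F such that [c * x] is in R_F. *)
Definition conductor x := A x /\ A (c * x).

Let J := conductor.

Lemma conductorD x y : J x -> J y -> J (x + y).
Proof. by move=> [x1 x2] [y1 y2]; split; rewrite ?mulrDr; apply: inRFD. Qed.

Lemma conductorM a x : A a -> J x -> J (a * x).
Proof. by move=> Aa [x1 x2]; split; rewrite ?[c * _]mulrCA; apply: inRFM. Qed.

Lemma conductorN x : J x -> J (- x).
Proof. by move=> [x1 x2]; split; rewrite ?mulrN; apply: inRFN. Qed.

Lemma conductor0 : J 0.
Proof. by split; rewrite ?mulr0; apply: inRF0. Qed.

(** Congruence modulo the conductor, carrying membership in R_F so that it is compatible with
    products and hence with determinants. *)
Definition congr_cond x y := [/\ A x, A y & J (x - y)].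

Let cg := congr_cond.

Lemma congr_cond_refl x : A x -> cg x x.
Proof. by move=> Ax; split => //; rewrite subrr; apply: conductor0. Qed.

Lemma congr_cond_eq x y x' y' : x = x' -> y = y' -> cg x' y' -> cg x y.
Proof. by move=> -> ->. Qed.

Lemma congr_cond0 x y : cg x y -> y = 0 -> A (c * x).
Proof. by move=> [_ _ [_ Jxy]] y0; move: Jxy; rewrite y0 subr0. Qed.

Lemma congr_condD x y x' y' : cg x y -> cg x' y' -> cg (x + x') (y + y').
Proof.
move=> [Ax Ay Jxy] [Ax' Ay' Jxy']; split; try exact: inRFD.
by rewrite opprD addrACA; apply: conductorD.
Qed.

Lemma congr_condM x y x' y' : cg x y -> cg x' y' -> cg (x * x') (y * y').
Proof.
move=> [Ax Ay Jxy] [Ax' Ay' Jxy']; split; try exact: inRFM.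
have -> : x * x' - y * y' = x' * (x - y) + y * (x' - y') by ring.
by apply: conductorD; apply: conductorM.
Qed.

Lemma congr_cond_det n (M M' : 'M[Kfr]_n) :
  (forall i j, cg (M i j) (M' i j)) -> cg (\det M) (\det M').
Proof.
move=> MM; rewrite /determinant.
elim/big_ind2: _ => [|x y x' y'|s _]; first by apply: congr_cond_refl; apply: inRF0.
  exact: congr_condD.
apply: congr_condM; first by apply: congr_cond_refl; apply: inRF_sign.
elim/big_ind2: _ => [|x y x' y'|i _ //]; first by apply: congr_cond_refl; apply: inRF1.
exact: congr_condM.
Qed.

(** The vanishing determinant at f0, f1, f2 is congruent to N(f), which therefore lies in the
    conductor. *)
Lemma conductor_det_pencil (f f0 f1 f2 : Kfr) : cg f f0 -> cg f f1 -> cg f f2 ->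
  \det (tens3 (pencil P m tofc f0) (pencil P m tofc f1) (pencil P m tofc f2) - 1%:M) = 0 ->
  A (c * (map_poly tofc (resultant_poly P m)).[f]).
Proof.
move=> c0 c1 c2 D0; rewrite (horner_resultant P m tofc).
have cgT x y r s : cg x y -> cg (pencil P m tofc x r s) (pencil P m tofc y r s).
  move=> cxy; rewrite !pencilE; apply: congr_condD; first by apply: congr_cond_refl; apply: inRF_tofc.
  by apply: congr_condM => //; apply: congr_cond_refl; apply: inRF_tofc.
have cgM : cg (\det (tens3 (pencil P m tofc f) (pencil P m tofc f) (pencil P m tofc f) - 1%:M))
          (\det (tens3 (pencil P m tofc f0) (pencil P m tofc f1) (pencil P m tofc f2) - 1%:M)).
  apply: congr_cond_det => r s.
  case: (mxtens_indexP r) => r' r3; case: (mxtens_indexP r') => r1 r2.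
  case: (mxtens_indexP s) => s' s3; case: (mxtens_indexP s') => s1 s2.
  apply: (congr_cond_eq (tens3_sub1E _ _ _ _ _ _ _ _ _) (tens3_sub1E _ _ _ _ _ _ _ _ _)).
  apply: congr_condD.
    by apply: congr_condM; [apply: congr_condM|]; apply: cgT.
  apply: congr_cond_refl; apply: inRFN => //.
  by case: andb; [exact: inRF1 | exact: inRF0].
exact: congr_cond0 cgM D0.
Qed.

Hypothesis c1 : A (c * (Fi 1 - Fi 0)).
Hypothesis c2 : A (c * (Fi 2 - Fi 1)).

Let AF i : A (Fi i).
Proof. exact: inRF_Ft. Qed.

Lemma conductor_Ft i j : J (Fi i - Fi j).
Proof.
have j1 : J (Fi 1 - Fi 0) by split => //; apply: inRFB.
have j2 : J (Fi 2 - Fi 1) by split => //; apply: inRFB.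
suff H k : J (Fi k - Fi 0).
  have -> : Fi i - Fi j = (Fi i - Fi 0) + - (Fi j - Fi 0) by ring.
  by apply: conductorD => //; apply: conductorN.
elim/ord3P: k => //; first by rewrite subrr; apply: conductor0.
have -> : Fi 2 - Fi 0 = (Fi 2 - Fi 1) + (Fi 1 - Fi 0) by ring.
exact: conductorD.
Qed.

Lemma conductor_resultant k : A (c * (map_poly tofc (resultant_poly P m)).[Fi k]).
Proof.
have cF i : cg (Fi k) (Fi i) by split => //; apply: conductor_Ft.
apply: (conductor_det_pencil (cF 0) (cF 1) (cF 2)).
apply: (@det_pencil_eq0 P m mP Kfr tofc (fun i => Fi i) tvar) => [i|].
  rewrite -map_intr_tofc /Ft /pev mulrAC mulVf ?mul1r //.
  exact: expf_neq0 (tvar_neq0 _).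
by have := prod_tvar; rewrite big_ord3.
Qed.

(** Multiplied by a power of t_k, the conductor element N(F(t_k)) becomes r(t_k), with the same
    nonzero r for every k. Making r monic prepares a division with remainder. *)
Lemma conductor_one_variable : exists2 r : {poly rat}, r \is monic &
  A (c * tof (map_poly polyC r)) /\ A (c * tof r%:P).
Proof.
have mPq : (m < (size (map_poly intr P : {poly rat})).-1)%N.
  by rewrite size_map_inj_poly ?mulr0z // => a b /intr_inj.
have [r r0 rP] := cleared_comp_poly mPq (resultant_poly_neq0 mP rootP).
have At k : A (c * (map_poly tofc r).[tvar k]).
  have := rP Kfr tofc _ (tvar_neq0 k); rewrite -map_intr_tofc -/(pev m P (tvar k)) => <-.
  rewrite mulrA; apply: inRFM => //; first exact: conductor_resultant.
  by apply: inRF_laurent; apply: laurentX; apply: laurent_tvar.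
have lr : lead_coef r != 0 by rewrite lead_coef_eq0.
exists ((lead_coef r)^-1 *: r); first by rewrite monicE lead_coefZ mulVf.
have AZ x : A (c * x) -> A (c * (tofc (lead_coef r)^-1 * x)).
  by move=> Ax; rewrite mulrCA; apply: inRFM => //; apply: inRF_tofc.
split.
  rewrite map_polyZ -mul_polyC tofM; apply: AZ.
  by have := At 0; rewrite tvar0 horner_t1.
rewrite -mul_polyC polyCM tofM; apply: AZ.
by have := At 1; rewrite tvar1 horner_t2.
Qed.

Theorem Ft_regular : A c.
Proof.
have [r rm [/inRF_laurent_pow[n1 h1] /inRF_laurent_pow[n2 h2]]] := conductor_one_variable.
have [k1 [q1 e1]] := h1 (n1 + n2)%N (leq_addr _ _).
have [k2 [q2 e2]] := h2 (n1 + n2)%N (leq_addl _ _).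
(* Up to units of R_F this is c; it will be a polynomial, because its products with r(t1) and r(t2)
   are. *)
pose s := c * Fprod m P ^+ (n1 + n2) * (t1 * t2) ^+ (k1 + k2).
pose rX : Tpol := map_poly polyC r; pose rY : Tpol := r%:P.
have {}e1 : s * tof rX = tof (q1 * ('X * ('X)%:P) ^+ k2).
  by rewrite tofM -tof_t1t2 -e1 /s /rX [(t1 * t2) ^+ _]exprD; ring.
have {}e2 : s * tof rY = tof (q2 * ('X * ('X)%:P) ^+ k1).
  by rewrite tofM -tof_t1t2 -e2 /s /rY [(t1 * t2) ^+ _]exprD; ring.
move: (q1 * _) (q2 * _) e1 e2 => {}q1 {}q2 e1 e2.
have e : q1 * rY = q2 * rX.
  by apply: tof_inj; rewrite !tofM -e1 -e2; ring.
have rXm : rX \is monic by rewrite map_monic.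
have rY0 : rY != 0 by rewrite polyC_eq0 monic_neq0.
(* Division by r(t1) in the outer variable. The remainder times r(t2), a constant in t1, is a
   multiple of r(t1), so comparing degrees in t1 forces the remainder to be 0. *)
have q1E := Pdiv.RingMonic.rdivp_eq rXm q1.
move: q1E; set g := Pdiv.Ring.rdivp _ _; set b := Pdiv.Ring.rmodp _ _ => q1E.
have eb : b * rY = (q2 - g * rY) * rX.
  by rewrite mulrBl -e q1E; ring.
have sb : (size b < size rX)%N by rewrite Pdiv.Ring.ltn_rmodp monic_neq0.
have b0 : b = 0.
  apply/eqP; apply: contraT => b0.
  have h0 : q2 - g * rY != 0.
    by apply: contraNneq b0 => h0; move: eb; rewrite h0 mul0r => /eqP; rewrite mulf_eq0 (negPf rY0) orbF.
  have := congr1 (fun q : Tpol => size q) eb.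
  rewrite mulrC size_Cmul ?monic_neq0 // (size_mul h0 (monic_neq0 rXm)) => sb'.
  move: h0 sb'; rewrite -size_poly_gt0; case: (size (q2 - _)) => // k _.
  by rewrite addSn /= => sb'; move: sb; rewrite sb' ltnNge leq_addl.
apply/inRFP; exists (n1 + n2)%N, (k1 + k2)%N, g.
have rX0 : tof rX != 0 by rewrite tof_eq0 monic_neq0.
by apply: (mulIf rX0); rewrite -/s e1 -tofM q1E b0 addr0.
Qed.

End Congruence.
End Regularity.

(** * The Weyl triangulation and its cochains *)

Lemma vaddE v w j : vadd v w j = v j + w j. Proof. by rewrite ffunE. Qed.
Lemma avecE i j : avec i j = if j == i then 2%:Z else -1. Proof. by rewrite ffunE. Qed.
Lemma vtrE k v j : vtr k v j = v j + 3 * k j. Proof. by rewrite ffunE. Qed.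
Lemma vpermE w v j : vperm w v j = v ((w^-1)%g j). Proof. by rewrite ffunE. Qed.

(* Separates the three Lambda-orbits of vertices. *)
Definition cls (v : vtx) : int := modz (v 0) 3.

Lemma cls_range v : [|| cls v == 0, cls v == 1 | cls v == 2].
Proof. rewrite /cls; lia. Qed.

Lemma cls_add v i : cls (vadd v (avec i)) = ((cls v - 1) %% 3)%Z.
Proof. rewrite /cls vaddE avecE; case: ifP => _; lia. Qed.

Lemma cls_vtr k v : cls (vtr k v) = cls v.
Proof. rewrite /cls vtrE; lia. Qed.

Lemma cls_add_neq v i : cls (vadd v (avec i)) != cls v.
Proof. rewrite cls_add; have := cls_range v; move: (cls v) => c; lia. Qed.

Lemma vaddAC v i j : vadd (vadd v (avec i)) (avec j) = vadd (vadd v (avec j)) (avec i).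
Proof. by apply/ffunP => l; rewrite !vaddE addrAC. Qed.

(** The three vectors [avec] sum to zero, so a path along all of them closes up. *)
Lemma third_index (i k : 'I_3) : i != k ->
  exists j, [/\ j != i, j != k & forall v, vadd (vadd (vadd v (avec i)) (avec j)) (avec k) = v].
Proof.
have H (a b c : 'I_3) : (a != b) && (b != c) && (a != c) -> forall v,
   vadd (vadd (vadd v (avec a)) (avec b)) (avec c) = v.
  move=> abc v; apply/ffunP => l; rewrite !vaddE !avecE.
  move: abc; elim/ord3P: a; elim/ord3P: b; elim/ord3P: c => // _; elim/ord3P: l => /=; lia.
elim/ord3P: i; elim/ord3P: k => // _;
  by [exists 0; split => //; apply: H | exists 1; split => //; apply: H | exists 2; split => //; apply: H].
Qed.

Lemma vadd_avec_inj v i j : vadd v (avec i) = vadd v (avec j) -> i = j.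
Proof.
move=> /ffunP /(_ i); rewrite !vaddE !avecE eqxx.
by case: eqP => // _; lia.
Qed.

Lemma isvtx_add v i : isvtx v -> isvtx (vadd v (avec i)).
Proof.
move=> /andP[/eqP s /forallP d]; apply/andP; split.
  move: s; rewrite !big_ord3 !vaddE !avecE; elim/ord3P: i => /=; lia.
apply/forallP => k; apply/forallP => l; have /forallP /(_ l) := d k.
rewrite !vaddE !avecE; case: ifP; case: ifP; lia.
Qed.

Lemma isvtx_vtr k v : inLam k -> isvtx (vtr k v) = isvtx v.
Proof.
move=> /eqP kL; congr (_ && _).
  by move: kL; rewrite !big_ord3 !vtrE /= => kL; apply/eqP/eqP; lia.
by apply: eq_forallb => i; apply: eq_forallb => j; rewrite !vtrE; lia.
Qed.

Lemma vtr_add k v w : vtr k (vadd v w) = vadd (vtr k v) w.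
Proof. by apply/ffunP => j; rewrite !(vtrE, vaddE); ring. Qed.

Lemma vtr_inj k : injective (vtr k).
Proof.
move=> v w /ffunP e; apply/ffunP => j; by have := e j; rewrite !vtrE => /addIr.
Qed.

Lemma edge_add v i : isvtx v -> edge v (vadd v (avec i)).
Proof.
by move=> vv; rewrite /edge vv isvtx_add //=; apply/existsP; exists i; rewrite eqxx.
Qed.

Lemma edge_sym v w : edge v w = edge w v.
Proof.
rewrite /edge andbCA; congr (_ && (_ && _)).
by apply: eq_existsb => i; rewrite orbC.
Qed.

Lemma edgeP v w : edge v w ->
  [/\ isvtx v, isvtx w & exists i, w = vadd v (avec i) \/ v = vadd w (avec i)].
Proof.
move=> /and3P[vv vw /existsP[i /orP[/eqP e|/eqP e]]]; split => //; exists i; by [left|right].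
Qed.

Lemma edge_cls v w : edge v w -> cls v != cls w.
Proof.
by move=> /edgeP[_ _ [i [->|->]]]; rewrite ?cls_add_neq // eq_sym cls_add_neq.
Qed.

Lemma vperm_avec w i : vperm w (avec i) = avec (w i).
Proof.
apply/ffunP => j; rewrite vpermE !avecE.
by rewrite -(inj_eq (@perm_inj _ w)) permKV.
Qed.

Lemma vperm_add w v v' : vperm w (vadd v v') = vadd (vperm w v) (vperm w v').
Proof. by apply/ffunP => j; rewrite !(vpermE, vaddE). Qed.

Lemma vperm_vtr w k v : vperm w (vtr k v) = vtr (vperm w k) (vperm w v).
Proof. by apply/ffunP => j; rewrite !(vpermE, vtrE). Qed.

Lemma inLam_vperm w k : inLam (vperm w k) = inLam k.
Proof.
rewrite /inLam (reindex_perm w) /=; congr (_ == _).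
by apply: eq_bigr => i _; rewrite vpermE permK.
Qed.

Lemma isvtx_vperm w v : isvtx v -> isvtx (vperm w v).
Proof.
move=> /andP[s /forallP d]; apply/andP; split; first by rewrite -/(inLam _) inLam_vperm.
by apply/forallP => i; apply/forallP => j; rewrite !vpermE; have /forallP := d ((w^-1)%g i).
Qed.

Lemma edge_vperm w v v' : edge v v' -> edge (vperm w v) (vperm w v').
Proof.
move=> /edgeP[vv vv' [i [e|e]]]; rewrite e vperm_add vperm_avec ?(edge_sym (vadd _ _)).
  by apply: edge_add; apply: isvtx_vperm.
by apply: edge_add; apply: isvtx_vperm.
Qed.

Lemma simplex_vperm w k s : simplex k s -> simplex k (map (vperm w) s).
Proof.
move=> /andP[/andP[sz vs] ps]; rewrite /simplex size_map sz all_map; apply/andP; split.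
  by apply: sub_all vs => v; apply: isvtx_vperm.
by rewrite pairwise_map; apply: sub_pairwise ps => v v'; apply: edge_vperm.
Qed.

Lemma simplex0 v : simplex 0 [:: v] = isvtx v.
Proof. by rewrite /simplex /= !andbT. Qed.

Lemma edge_vtx v w : edge v w -> isvtx v /\ isvtx w.
Proof. by case/and3P. Qed.

Lemma simplex1 v w : simplex 1 [:: v; w] = edge v w.
Proof.
rewrite /simplex /= !andbT; case e: (edge v w); last by rewrite andbF.
by have [-> ->] := edge_vtx e.
Qed.

Lemma simplex2 x y z : simplex 2 [:: x; y; z] = [&& edge x y, edge x z & edge y z].
Proof.
rewrite /simplex /= !andbT; case e: (edge x y); rewrite ?andbF //=.
case e': (edge y z); rewrite ?andbF //= !andbT.
have [-> ->] := edge_vtx e; by have [_ ->] := edge_vtx e'.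
Qed.

(** Adjacent vertices have different classes modulo 3, so a clique has at most three vertices. *)
Lemma simplex_dim_le2 k s : simplex k s -> (k <= 2)%N.
Proof.
case: k => [|[|[|k]]] //; rewrite /simplex; case: s => [|x [|y [|z [|w s]]]] //=.
move=> /andP[_ /and5P[/and4P[xy xz xw _] /and3P[yz yw _] /andP[zw _] _ _]].
have := edge_cls xy; have := edge_cls xz; have := edge_cls xw; have := edge_cls yz.
have := edge_cls yw; have := edge_cls zw.
have := cls_range x; have := cls_range y; have := cls_range z; have := cls_range w.
move: (cls x) (cls y) (cls z) (cls w) => a b c d; lia.
Qed.

Lemma triangle_simplex v i j : isvtx v -> i != j ->
  simplex 2 [:: v; vadd v (avec i); vadd (vadd v (avec i)) (avec j)].
Proof.
move=> vv ij; rewrite simplex2 !edge_add ?isvtx_add //= andbT.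
have [k [_ _ e]] := third_index ij.
have vw := isvtx_add j (isvtx_add i vv).
by have := edge_add k vw; rewrite (vaddAC _ j k) e edge_sym.
Qed.

(** Seen from x, one other vertex lies a step ahead and one a step behind, since two on the same
    side would have equal classes. *)
Lemma triangle_cases x y z : simplex 2 [:: x; y; z] ->
  exists i j, i != j /\
    ((y = vadd x (avec i) /\ z = vadd y (avec j)) \/ (z = vadd x (avec i) /\ y = vadd z (avec j))).
Proof.
have H x' y' z' i k : edge y' z' -> y' = vadd x' (avec i) -> x' = vadd z' (avec k) ->
    exists i j, i != j /\ (y' = vadd x' (avec i) /\ z' = vadd y' (avec j)).
  (* If i = k, then y' - z' would be 2 a_i, which is not an edge vector. *)
  move=> yz ey ex; have ik : i != k.
    apply/eqP => ik; subst i; move: yz => /edgeP[_ _ [l [e|e]]].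
      have := congr1 (fun v : vtx => v k) e; rewrite ey ex !vaddE !avecE eqxx; case: ifP; lia.
    by have := congr1 (fun v : vtx => v k) e; rewrite ey ex !vaddE !avecE eqxx; case: ifP; lia.
  have [j [ji jk e]] := third_index ik.
  exists i, j; split; first by rewrite eq_sym.
  split => //; have := e x'; rewrite {2}ex -ey => /ffunP e'.
  by apply/ffunP => l; have := e' l; rewrite !vaddE => /addIr.
rewrite simplex2 => /and3P[xy xz yz].
have /edgeP[_ _ [i [ey|ey]]] := xy; have /edgeP[_ _ [k [ez|ez]]] := xz.
- by have := edge_cls yz; rewrite ey ez !cls_add eqxx.
- by have [a [b [ab ?]]] := H _ _ _ _ _ yz ey ez; exists a, b; split => //; left.
- rewrite edge_sym in yz; have [a [b [ab ?]]] := H _ _ _ _ _ yz ez ey.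
  by exists a, b; split => //; right.
- have := edge_cls yz.
  have e1 := cls_add y i; have e2 := cls_add z k; rewrite -ey in e1; rewrite -ez in e2.
  move: e1 e2 (cls_range y) (cls_range z); move: (cls x) (cls y) (cls z) => a b c; lia.
Qed.

Definition vzero : vtx := [ffun=> 0].

Lemma isvtx0 : isvtx vzero.
Proof.
apply/andP; split; first by rewrite big1 // => i _; rewrite ffunE.
by apply/forallP => i; apply/forallP => j; rewrite !ffunE.
Qed.

Lemma cls0_vtr v : isvtx v -> cls v = 0 -> exists2 k, inLam k & v = vtr k vzero.
Proof.
move=> /andP[/eqP s /forallP d] c.
have m3 j : (3 %| v j)%Z.
  have /forallP /(_ 0) := d j; move: c; rewrite /cls; lia.
have e : v = vtr [ffun j => (v j %/ 3)%Z] vzero.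
  by apply/ffunP => j; rewrite vtrE !ffunE add0r mulrC divzK.
exists [ffun j => (v j %/ 3)%Z] => //; rewrite /inLam.
by move: s (m3 0) (m3 1) (m3 2); rewrite !big_ord3 !ffunE /= => s' h0 h1 h2; apply/eqP; lia.
Qed.

Lemma delta0E phi x y : delta 0 phi [:: x; y] = phi [:: y] - phi [:: x].
Proof. by rewrite /delta !big_ord_recl big_ord0 /= expr0 expr1 mul1r mulN1r addr0. Qed.

Lemma delta1E phi x y z :
  delta 1 phi [:: x; y; z] = phi [:: y; z] - phi [:: x; z] + phi [:: x; y].
Proof.
by rewrite /delta !big_ord_recl big_ord0 /= /bump /= expr0 expr1 sqrrN expr1n !mul1r mulN1r addr0 addrA.
Qed.

Lemma simplex1P s : simplex 1 s -> exists x y, s = [:: x; y].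
Proof. by rewrite /simplex; case: s => [|x [|y [|z s]]] //=; exists x, y. Qed.

Lemma simplex2P s : simplex 2 s -> exists x y z, s = [:: x; y; z].
Proof. by rewrite /simplex; case: s => [|x [|y [|z [|w s]]]] //=; exists x, y, z. Qed.

Definition root_vec (i j : 'I_3) : vtx := [ffun l => (l == i)%:Z - (l == j)%:Z].

Lemma inLam_root i j : inLam (root_vec i j).
Proof.
rewrite /inLam (eq_bigr (fun l => (l == i)%:Z - (l == j)%:Z)) => [|l _]; last by rewrite ffunE.
have H k : \sum_(l < 3) (l == k)%:Z = 1.
  by rewrite (bigD1 k) //= eqxx big1 ?addr0 // => l /negPf ->.
by rewrite big_split /= sumrN !H subrr.
Qed.

(** As a_i - a_j = 3 (e_i - e_j), the translate of v is reached by stepping along a_i and back along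
    a_j. *)
Lemma root_add i j v : vadd (vtr (root_vec i j) v) (avec j) = vadd v (avec i).
Proof.
apply/ffunP => l; rewrite !vaddE vtrE !avecE ffunE.
by case: (l == i); case: (l == j); rewrite /=; lia.
Qed.

Lemma cross_mul (K : fieldType) (a b x y : K) :
  a != 0 -> b != 0 -> a^-1 * x = b^-1 * y -> x * b = y * a.
Proof.
move=> a0 b0 e; have -> : x = a * (a^-1 * x) by rewrite mulrA mulfV // mul1r.
by rewrite e; field.
Qed.

Lemma mulf_div_sub (K : fieldType) (a b c : K) : c != 0 -> (b / c - 1) * a * c = a * (b - c).
Proof. by move=> c0; field. Qed.

(** * Vanishing of the cohomology in degrees other than two *)

Section Cohomology.
Variables (m : nat) (P : {poly int}).
Hypothesis mP : (m < (size P).-1)%N.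
Variable (C : numClosedFieldType).
Hypothesis rootP : forall z : C, root (map_poly intr P) z -> z <= 0.
Local Notation Fi i := (Ft m P i).
Local Notation A := (inRF m P).
Local Notation u := (uLam m P).

Let P_neq0 : P != 0.
Proof. by apply: contraTneq mP => ->; rewrite size_poly0. Qed.

Let Fn0 i : Fi i != 0.
Proof. exact: Ft_neq0. Qed.

Lemma uLam_root i j : u (root_vec i j) = Fi i / Fi j.
Proof.
rewrite /uLam (eq_bigr (fun l => (if l == i then Fi i else 1) * (if l == j then (Fi j)^-1 else 1))).
  by rewrite big_split -!big_mkcond !big_pred1_eq.
move=> l _; rewrite ffunE.
case: (eqVneq l i) => [->|li]; case: (eqVneq _ j) => [<-|lj] /=.
- by rewrite subrr expr0z mulfV.
- by rewrite subr0 expr1z mulr1.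
- by rewrite sub0r exprN1 mul1r.
- by rewrite subrr expr0z mulr1.
Qed.

(** With denominators cleared, P(t1) t2^m and P(t2) t1^m have degrees deg P and m in t1. *)
Lemma Ft01_neq : Fi 0 != Fi 1.
Proof.
apply/eqP => e; have := mP; rewrite ltnNge; case/negP.
pose Q : {poly rat} := map_poly intr P.
have sQ : size Q = size P by rewrite size_map_inj_poly ?mulr0z // => a b /intr_inj.
have Q0 : Q != 0 by rewrite -size_poly_eq0 sQ size_poly_eq0.
have e' : tof (map_poly polyC Q) * tof (('X ^+ m)%:P) = tof Q%:P * tof ('X ^+ m).
  have X1 : tof ('X ^+ m) = t1 ^+ m by rewrite tofXn.
  have X2 : tof (('X ^+ m)%:P) = t2 ^+ m by rewrite rmorphXn tofXn.
  rewrite X1 X2 -horner_t1 -horner_t2 -map_intr_tofc.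
  have n1 : t1 ^+ m != 0 := expf_neq0 m t1_neq0.
  have n2 : t2 ^+ m != 0 := expf_neq0 m t2_neq0.
  exact: cross_mul n1 n2 e.
have {}e' : map_poly polyC Q * ('X ^+ m)%:P = Q%:P * 'X ^+ m :> Tpol.
  by apply: tof_inj; rewrite !tofM.
have := congr1 (fun q : Tpol => size q) e'.
rewrite mulrC size_Cmul ?expf_neq0 ?polyX_eq0 //.
rewrite size_map_polyC size_Cmul // size_polyXn sQ => ->.
by [].
Qed.

Lemma uLam01_neq1 : u (root_vec 0 1) != 1.
Proof.
rewrite uLam_root; apply/eqP => e; have := Ft01_neq; rewrite -[Fi 0](divfK (Fn0 1)) e mul1r.
by rewrite eqxx.
Qed.

Lemma no_high_cohomology k phi : (2 < k)%N -> coboundary m P k phi.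
Proof.
case: k => // k k2; exists (fun=> 0); split; last first.
  by move=> s /simplex_dim_le2; rewrite leqNgt k2.
split => [s _|s1 x y s2 _|kk s _ _]; rewrite ?oppr0 ?mulr0 //.
exact: inRF0.
Qed.

(** A 0-cocycle is constant along edges, hence unchanged by translation by a root, which also
    multiplies it by some u different from 1. *)
Lemma cohomology0 phi : cochain m P 0 phi -> cocycle 0 phi -> coboundary m P 0 phi.
Proof.
move=> [_ _ eqv] cc s ss.
have [v e] : exists v, s = [:: v] by case: s ss => [|v [|w s]] //; exists v.
subst s; rewrite simplex0 in ss.
have step w i : isvtx w -> phi [:: vadd w (avec i)] = phi [:: w].
  move=> vw; apply/eqP; rewrite -subr_eq0 -delta0E; apply/eqP/cc.
  by rewrite simplex1 edge_add.
have L := inLam_root 0 1.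
have := eqv (root_vec 0 1) [:: v] L; rewrite simplex0 => /(_ ss) /=.
rewrite -(step _ 1) ?isvtx_vtr // root_add step // => /eqP.
rewrite -subr_eq0 -{1}[phi _]mul1r -mulrBl mulf_eq0 subr_eq0 eq_sym (negPf uLam01_neq1) /=.
by move/eqP.
Qed.

Section DegreeOne.
Variable phi : seq vtx -> Kfr.
Hypothesis cphi : cochain m P 1 phi.

Definition edge_value i v := phi [:: v; vadd v (avec i)].
Let al := edge_value.

Lemma edge_value_vtr kk i v : inLam kk -> isvtx v -> al i (vtr kk v) = u kk * al i v.
Proof.
move=> kL vv; case: cphi => _ _ /(_ kk [:: v; vadd v (avec i)] kL).
by rewrite simplex1 edge_add //= vtr_add => /(_ isT).
Qed.

Lemma edge_value_opp i v : isvtx v -> phi [:: vadd v (avec i); v] = - al i v.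
Proof.
move=> vv; case: cphi => _ + _ => /(_ [::] v (vadd v (avec i)) [::]).
by apply; rewrite simplex1 edge_add.
Qed.

Lemma edge_value_inRF i v : isvtx v -> A (al i v).
Proof. by move=> vv; case: cphi => + _ _; apply; rewrite simplex1 edge_add. Qed.

Hypothesis zphi : cocycle 1 phi.

(** For i different from l, the triangles along a_i, a_l and along a_l, a_i share the edge from v to
    v + a_i + a_l. *)
Lemma edge_value_comm i l v : isvtx v ->
  al i v + al l (vadd v (avec i)) = al l v + al i (vadd v (avec l)).
Proof.
move=> vv; have [->//|il] := eqVneq i l.
have H a b : a != b -> al a v + al b (vadd v (avec a)) = phi [:: v; vadd (vadd v (avec a)) (avec b)].
  move=> ab; have := zphi (triangle_simplex vv ab); rewrite delta1E => e.
  by apply/eqP; rewrite -subr_eq0 -e /al /edge_value; apply/eqP; ring.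
by rewrite !H // 1?eq_sym // vaddAC.
Qed.

(** The integral of [phi] along the two-edge path from v to its translate by [root_vec i j]. *)
Definition path_value i j v := al i v - al j (vtr (root_vec i j) v).

(** Homotopy of paths: moving the starting point along an edge changes the integral by the
    translated edge value minus the original one. *)
Lemma path_value_diff i j l v : isvtx v ->
  path_value i j (vadd v (avec l)) - path_value i j v = (u (root_vec i j) - 1) * al l v.
Proof.
move=> vv; have L := inLam_root i j.
have vv' : isvtx (vtr (root_vec i j) v) by rewrite isvtx_vtr.
have e1 := edge_value_comm i l vv.
have e2 := edge_value_comm j l vv'; rewrite root_add (edge_value_vtr l L vv) in e2.
rewrite /path_value vtr_add.
move: (al i v) (al l v) (al l (vadd v (avec i))) (al i (vadd v (avec l)))
  (al j (vtr (root_vec i j) v)) (al j (vadd (vtr (root_vec i j) v) (avec l))) (u (root_vec i j)) e1 e2.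
move=> a b c d e f w e1 e2.
have -> : d = a + c - b by rewrite e1; ring.
have -> : f = e + c - w * b.
  apply/eqP; rewrite -subr_eq0.
  have -> : f - (e + c - w * b) = (w * b + f) - (e + c) by ring.
  by rewrite -e2 subrr.
ring.
Qed.

Lemma path_value_vtr kk i j v : inLam kk -> isvtx v ->
  path_value i j (vtr kk v) = u kk * path_value i j v.
Proof.
move=> kL vv; have L := inLam_root i j.
have vv' : isvtx (vtr (root_vec i j) v) by rewrite isvtx_vtr.
have -> : path_value i j (vtr kk v) = al i (vtr kk v) - al j (vtr kk (vtr (root_vec i j) v)).
  by congr (_ - al j _); apply/ffunP => l; rewrite !vtrE addrAC.
by rewrite (edge_value_vtr i kL vv) (edge_value_vtr j kL vv') -mulrBr.
Qed.

(* Both sides are the variation of one path value along the other path. *)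
Lemma path_value_exchange i j k l v : isvtx v ->
  (u (root_vec i j) - 1) * path_value k l v = (u (root_vec k l) - 1) * path_value i j v.
Proof.
move=> vv; have L := inLam_root k l.
have vv' : isvtx (vtr (root_vec k l) v) by rewrite isvtx_vtr.
rewrite {1}/path_value mulrBr -!path_value_diff // root_add path_value_vtr //.
ring.
Qed.

Lemma cohomology1 : coboundary m P 1 phi.
Proof.
pose w := u (root_vec 0 1) - 1.
have w0 : w != 0 by rewrite subr_eq0 uLam01_neq1.
(* By [path_value_diff] this is a primitive over the fraction field; what remains is that its values
   lie in R_F. *)
pose psi v := path_value 0 1 v / w.
have psiA v : isvtx v -> A (psi v).
  move=> vv.
  (* The exchange identity turns psi (F_k - F_l) into a path value times F_l, so regularity applies
     to psi. *)
  have key k l : A (psi v * (Fi k - Fi l)).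
    have -> : psi v * (Fi k - Fi l) = path_value k l v * Fi l.
      have e := path_value_exchange 0 1 k l vv; rewrite -/w in e.
      apply: (mulfI w0); rewrite [RHS]mulrA e uLam_root (mulf_div_sub _ _ (Fn0 l)).
      by rewrite /psi mulrA mulrCA mulfV // mulr1.
    apply: inRFM => //; last exact: inRF_Ft.
    apply: inRFB; apply: edge_value_inRF => //.
    by rewrite isvtx_vtr // inLam_root.
  exact: (Ft_regular mP rootP (key 1 0) (key 2 1)).
have dpsi l v : isvtx v -> psi (vadd v (avec l)) - psi v = al l v.
  by move=> vv; rewrite /psi -mulrBl path_value_diff // mulrAC mulfV // mul1r.
exists (fun s => if s is [:: v] then psi v else 0); split.
  split.
  - by move=> [|v [|? ?]] //; rewrite simplex0; apply: psiA.
  - by move=> [|? [|? ?]] x y [|? ?].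
  - move=> kk [|v [|? ?]] // kL; rewrite simplex0 => vv /=.
    by rewrite /psi path_value_vtr // mulrA.
move=> s ss; have [x [y e]] := simplex1P ss; subst s.
rewrite delta0E; move: ss; rewrite simplex1 => /edgeP[vx vy [i [e|e]]]; subst.
  by rewrite dpsi.
by rewrite edge_value_opp // -dpsi // opprB.
Qed.

End DegreeOne.
End Cohomology.

Lemma simplex2_split s1 x y s2 : simplex 2 (s1 ++ x :: y :: s2) ->
  (s1 = [::] /\ exists c, s2 = [:: c]) \/ ((exists a, s1 = [:: a]) /\ s2 = [::]).
Proof.
move=> /andP[/andP[/eqP sz _] _]; move: sz; rewrite size_cat /=.
case: s1 => [|a [|b s1]]; case: s2 => [|c [|d s2]] //=; try by lia.
- by left; split=> //; exists c.
- by right; split=> //; exists a.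
Qed.

Definition tri (i j : 'I_3) : seq vtx :=
  [:: vzero; vadd vzero (avec i); vadd (vadd vzero (avec i)) (avec j)].

Lemma tri_simplex i j : i != j -> simplex 2 (tri i j).
Proof. exact: triangle_simplex isvtx0. Qed.

(* The sign of the permutation (0, 1, 2) |-> (i, j, k), where k is the third index. *)
Definition orient (i j : 'I_3) : int := if j == i + 1 then 1 else if i == j + 1 then -1 else 0.

Lemma sum_orient (K : comPzRingType) (f : 'I_3 -> 'I_3 -> K) :
  \sum_i \sum_j (orient i j)%:~R * f i j = f 0 1 - f 0 2 + f 1 2 - f 1 0 + f 2 0 - f 2 1.
Proof. rewrite !big_ord3 /= /orient /=; ring. Qed.

(** Each triangle has exactly one vertex of class 0, so the six triangles around the origin
    represent every Lambda-orbit once. *)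
Definition fund_sum (phi : seq vtx -> Kfr) : Kfr :=
  \sum_i \sum_j (orient i j)%:~R * phi (tri i j).

Lemma fund_sumE phi : fund_sum phi =
  phi (tri 0 1) - phi (tri 0 2) + phi (tri 1 2) - phi (tri 1 0) + phi (tri 2 0) - phi (tri 2 1).
Proof. exact: sum_orient. Qed.

Lemma eq_fund_sum phi psi : (forall i j, i != j -> phi (tri i j) = psi (tri i j)) ->
  fund_sum phi = fund_sum psi.
Proof. by move=> e; rewrite !fund_sumE !e. Qed.

Lemma orient_perm (w : 'S_3) i j : orient (w i) (w j) = (-1) ^+ odd_perm w * orient i j.
Proof.
have [ts -> dts] := prod_tpermP w.
elim: ts dts i j => [|[a b] ts IHts] /= dts i j.
  by rewrite big_nil !perm1 odd_perm1 expr0 mul1r.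
case/andP: dts => ab dts; rewrite big_cons !permM IHts // odd_permM signr_addb -mulrA mulrCA.
congr (_ * _); rewrite odd_tperm ab expr1.
move: ab; elim/ord3P: a; elim/ord3P: b => // _; elim/ord3P: i; elim/ord3P: j;
  rewrite ?permE //=.
Qed.

Lemma vperm_tri w i j : map (vperm w) (tri i j) = tri (w i) (w j).
Proof.
have z : vperm w vzero = vzero by apply/ffunP => l; rewrite vpermE !ffunE.
by rewrite /= !vperm_add !vperm_avec z.
Qed.

Lemma sigmaW_sum w (I : finType) (f : I -> Kfr) :
  sigmaW w (\sum_i f i) = \sum_i sigmaW w (f i).
Proof. exact: rmorph_sum. Qed.

Lemma sigmaW_int w z : sigmaW w z%:~R = z%:~R.
Proof. exact: rmorph_int. Qed.

(** W permutes the six triangles, and w changes their orientation by its sign. *)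
Lemma fund_sum_wact w phi : fund_sum (wact w phi) = (-1) ^+ odd_perm w * sigmaW w (fund_sum phi).
Proof.
rewrite /fund_sum (reindex_perm w) sigmaW_sum mulr_sumr; apply: eq_bigr => i _.
rewrite (reindex_perm w) sigmaW_sum mulr_sumr; apply: eq_bigr => j _.
rewrite /wact vperm_tri !permK orient_perm sigmaWM sigmaW_int intrM -!mulrA; congr (_ * _).
by rewrite rmorphXn rmorphN1.
Qed.

(** * The second cohomology group *)

Section DegreeTwo.
Variables (m : nat) (P : {poly int}).
Hypothesis mP : (m < (size P).-1)%N.
Local Notation Fi i := (Ft m P i).
Local Notation A := (inRF m P).
Local Notation u := (uLam m P).
Local Notation Fp := (Fprod m P).

Let P_neq0 : P != 0.
Proof. by apply: contraTneq mP => ->; rewrite size_poly0. Qed.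

Let Fn0 i : Fi i != 0.
Proof. exact: Ft_neq0. Qed.

(* Extends [uLam] from Lambda to all vertices, so that an equivariant cochain is
   [monom] times a function of the class of a vertex. *)
Definition monom (v : vtx) : Kfr := \prod_i Fi i ^ divz (v i) 3.

Lemma monom_inRF v : A (monom v).
Proof. by apply: inRF_prod => i _; apply: inRF_Ft_exp. Qed.

Lemma monom_vtr k v : monom (vtr k v) = u k * monom v.
Proof.
rewrite /monom /uLam -big_split; apply: eq_bigr => i _.
have d3 (a b : int) : divz (a + 3 * b) 3 = b + divz a 3 by lia.
by rewrite vtrE d3 expfzDr.
Qed.

Lemma monom0 : monom vzero = 1.
Proof. by rewrite /monom big1 // => i _; rewrite ffunE div0z expr0z. Qed.

Let div3_2 : divz 2 3 = 0. Proof. by []. Qed.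
Let div3_N1 : divz (-1) 3 = -1. Proof. by []. Qed.
Let div3_N2 : divz (-1 + -1) 3 = -1. Proof. by []. Qed.
Let div3_1 : divz (2 + -1) 3 = 0. Proof. by []. Qed.
Let div3_1' : divz (-1 + 2) 3 = 0. Proof. by []. Qed.

(** The coordinates 2, -1, -1 have integer quotients 0, -1, -1 by 3, which leaves the inverses of
    the other two characters. *)
Lemma monom_avec i : monom (vadd vzero (avec i)) = Fi i / Fp.
Proof.
have e : \prod_j Fi j * monom (vadd vzero (avec i)) = Fi i.
  rewrite /monom -big_split (bigD1 i) //= big1 => [|j ji].
    by rewrite vaddE avecE ffunE eqxx add0r div3_2 expr0z !mulr1.
  rewrite vaddE avecE ffunE (negPf ji) add0r div3_N1 exprN1; exact: mulfV.
rewrite -[in RHS]e -FprodE mulrC; apply/esym/mulKf; exact: Fprod_neq0.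
Qed.

Lemma monom_avec2 i j k : i != j -> j != k -> i != k ->
  monom (vadd (vadd vzero (avec i)) (avec j)) = (Fi k)^-1.
Proof.
move=> ij jk ik; have K l : l != k -> (l == i) || (l == j).
  by move: ij jk ik; elim/ord3P: i; elim/ord3P: j; elim/ord3P: k => //; elim/ord3P: l.
rewrite /monom (bigD1 k) //= big1 => [|l lk].
  rewrite !vaddE !avecE ffunE ![k == _]eq_sym (negPf ik) (negPf jk) add0r.
  by rewrite div3_N2 exprN1 mulr1.
rewrite !vaddE !avecE ffunE add0r; have := K l lk.
case: (eqVneq l i) => [->|li]; first by rewrite (negPf ij) div3_1 expr0z.
by move=> /= ->; rewrite div3_1' expr0z.
Qed.

Lemma cochain_sub k phi psi : cochain m P k phi -> cochain m P k psi ->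
  cochain m P k (fun s => phi s - psi s).
Proof.
move=> [a1 b1 c1] [a2 b2 c2]; split.
- by move=> s ss; apply: inRFB; [apply: a1|apply: a2].
- by move=> s1 x y s2 ss; rewrite b1 // b2 //; ring.
- by move=> kk s kL ss; rewrite c1 // c2 //; ring.
Qed.

Lemma cochain_scale_sign k phi e : cochain m P k phi -> cochain m P k (fun s => (-1) ^+ e * phi s).
Proof.
move=> [a1 b1 c1]; split.
- by move=> s ss; apply: inRFM; [apply: inRF_sign|apply: a1].
- by move=> s1 x y s2 ss; rewrite b1 //; ring.
- by move=> kk s kL ss; rewrite c1 //; ring.
Qed.

Lemma uLam_sigmaW w k : sigmaW w (u (vperm (w^-1)%g k)) = u k.
Proof.
rewrite /uLam rmorph_prod [RHS](reindex_perm w); apply: eq_bigr => i _ /=.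
by rewrite fmorphXz /= sigmaW_Ft vpermE invgK.
Qed.

Lemma cochain_wact w k phi : cochain m P k phi -> cochain m P k (wact w phi).
Proof.
move=> [a b c]; split.
- by move=> s ss; apply: inRF_sigmaW => //; apply: a; apply: simplex_vperm.
- move=> s1 x y s2 ss; have := simplex_vperm (w^-1)%g ss.
  by rewrite /wact !map_cat /= => ss'; rewrite b // sigmaWN.
- move=> kk s kL ss; have ss' := simplex_vperm (w^-1)%g ss.
  have -> : wact w phi (map (vtr kk) s)
      = sigmaW w (phi (map (vtr (vperm (w^-1)%g kk)) (map (vperm (w^-1)%g) s))).
    by rewrite /wact -!map_comp; congr (sigmaW w (phi _)); apply: eq_map => v /=; rewrite vperm_vtr.
  by rewrite c ?inLam_vperm // sigmaWM uLam_sigmaW.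
Qed.

(** Every triangle has a vertex of class 0; swaps bring it to the front and a translation brings it
    to the origin. *)
Lemma alternating_ext g :
  (forall s1 x y s2, simplex 2 (s1 ++ x :: y :: s2) ->
      g (s1 ++ y :: x :: s2) = - g (s1 ++ x :: y :: s2)) ->
  (forall kk s, inLam kk -> simplex 2 s -> g (map (vtr kk) s) = u kk * g s) ->
  (forall i j, i != j -> g (tri i j) = 0) ->
  forall s, simplex 2 s -> g s = 0.
Proof.
move=> galt gu g0 s ss; have [x [y [z e]]] := simplex2P ss; subst s.
have sw1 a b c : simplex 2 [:: a; b; c] -> g [:: b; a; c] = 0 -> g [:: a; b; c] = 0.
  by move=> sabc /eqP; rewrite (galt [::] a b [:: c]) // oppr_eq0 => /eqP.
have sw2 a b c : simplex 2 [:: a; b; c] -> g [:: a; c; b] = 0 -> g [:: a; b; c] = 0.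
  by move=> sabc /eqP; rewrite (galt [:: a] b c [::]) // oppr_eq0 => /eqP.
have swap1 a b c : simplex 2 [:: a; b; c] -> simplex 2 [:: b; a; c].
  by rewrite !simplex2 (edge_sym b a) => /and3P[-> -> ->].
have swap2 a b c : simplex 2 [:: a; b; c] -> simplex 2 [:: a; c; b].
  by rewrite !simplex2 (edge_sym c b) => /and3P[-> -> ->].
have base a b c : simplex 2 [:: a; b; c] -> cls a = 0 -> g [:: a; b; c] = 0.
  move=> sabc ca; have va : isvtx a by move: sabc; rewrite simplex2 => /and3P[/edge_vtx[]].
  have [k kL ae] := cls0_vtr va ca.
  have G i j : i != j -> g [:: a; vadd a (avec i); vadd (vadd a (avec i)) (avec j)] = 0.
    move=> ij; have := gu k (tri i j) kL (tri_simplex ij).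
    by rewrite g0 // mulr0 /= !vtr_add -ae.
  have [i [j [ij [[-> ->]|[-> ->]]]]] := triangle_cases sabc; first exact: G.
  apply: sw2; last exact: G.
  by apply: swap2; apply: triangle_simplex.
have := ss; rewrite simplex2 => /and3P[/edge_cls xy /edge_cls xz /edge_cls yz].
have [x0|x0] := eqVneq (cls x) 0; first exact: base.
have [y0|y0] := eqVneq (cls y) 0; first by apply: sw1 => //; apply: base => //; apply: swap1.
have z0 : cls z = 0.
  move: (cls_range x) (cls_range y) (cls_range z) xy xz yz x0 y0.
  move: (cls x) (cls y) (cls z) => a b c; lia.
apply: sw2 => //; apply: sw1; first exact: swap2.
by apply: base => //; apply: swap1; apply: swap2.
Qed.

(* The orbit of the single triangle [tri 0 1]. *)
Definition mark (x y z : vtx) : Kfr :=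
  if [&& cls x == 0, y == vadd x (avec 0) & z == vadd y (avec 1)] then monom x else 0.

Definition orbit_cochain (s : seq vtx) : Kfr :=
  if s is [:: x; y; z] then
    mark x y z + mark y z x + mark z x y - mark y x z - mark x z y - mark z y x
  else 0.

(** A representative of the class of p supported on one orbit of triangles; on cohomology it inverts
    [fund_sum]. *)
Definition Psi (p : Kfr) (s : seq vtx) : Kfr := p * orbit_cochain s.

Lemma mark_inRF x y z : A (mark x y z).
Proof. by rewrite /mark; case: ifP => _; [apply: monom_inRF | apply: inRF0]. Qed.

Lemma mark_vtr k x y z : mark (vtr k x) (vtr k y) (vtr k z) = u k * mark x y z.
Proof.
rewrite /mark cls_vtr -!vtr_add !(inj_eq (@vtr_inj k)).
by case: ifP => _; rewrite ?mulr0 // monom_vtr.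
Qed.

Lemma orbit_cochain_simplex s : simplex 2 s -> A (orbit_cochain s).
Proof.
move=> /simplex2P[x [y [z ->]]] /=.
by repeat first [apply: inRFB | apply: inRFD]; apply: mark_inRF.
Qed.

Lemma Psi_cochain p : A p -> cochain m P 2 (Psi p).
Proof.
move=> Ap; split.
- by move=> s ss; apply: inRFM => //; apply: orbit_cochain_simplex.
- by move=> s1 x y s2 /simplex2_split[[-> [c ->]]|[[a ->] ->]]; rewrite /Psi /=; ring.
- move=> kk s kL /simplex2P[x [y [z ->]]]; rewrite /Psi /= !mark_vtr; ring.
Qed.

Lemma mark0 a y z : cls y != 0 -> mark y z a = 0.
Proof. by rewrite /mark => /negPf ->. Qed.

(** Of the orders of a triangle only those starting at the origin can be marked, and of the six
    triangles only [tri 0 1] is. *)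
Lemma fund_sum_Psi p : fund_sum (Psi p) = p.
Proof.
have H i j : i != j -> Psi p (tri i j) = if (i == 0) && (j == 1) then p else 0.
  move=> ij; rewrite /Psi /tri; set y := vadd vzero _; set z := vadd y _.
  have c0 : cls vzero = 0 by rewrite /cls ffunE.
  have cy : cls y = 2 by rewrite cls_add c0.
  have cz : cls z = 1 by rewrite cls_add cy.
  have n1 : cls y != 0 by rewrite cy.
  have n2 : cls z != 0 by rewrite cz.
  rewrite /orbit_cochain !(mark0 _ _ n1) !(mark0 _ _ n2) !addr0 !subr0.
  have -> : mark vzero z y = 0.
    rewrite /mark; case: ifP => // /and3P[_ /eqP e _].
    by move: cz; rewrite e cls_add c0.
  rewrite subr0 /mark c0 eqxx monom0 /=.
  have -> : (y == vadd vzero (avec 0)) = (i == 0).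
    by apply/eqP/eqP => [/vadd_avec_inj|e] //; rewrite /y e.
  have -> : (z == vadd y (avec 1)) = (j == 1).
    by apply/eqP/eqP => [/vadd_avec_inj|e] //; rewrite /z e.
  by case: ifP => _; rewrite ?mulr1 ?mulr0.
by rewrite fund_sumE !H //= !subr0 !addr0.
Qed.

Lemma third_tri i j k : i != j -> j != k -> i != k ->
  vadd (vadd (vadd vzero (avec i)) (avec j)) (avec k) = vzero.
Proof.
move=> ij jk ik; have [l [li lk e]] := third_index ik.
have -> : j = l by move: ij jk li lk ik {e}; elim/ord3P: i; elim/ord3P: j; elim/ord3P: k => //; elim/ord3P: l.
exact: e.
Qed.

Lemma delta_tri psi i j k : cochain m P 1 psi -> i != j -> j != k -> i != k ->
  delta 1 psi (tri i j) = edge_value psi j (vadd vzero (avec i))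
    + edge_value psi k (vadd (vadd vzero (avec i)) (avec j)) + edge_value psi i vzero.
Proof.
move=> cpsi ij jk ik; rewrite delta1E /edge_value third_tri //.
have v2 : isvtx (vadd (vadd vzero (avec i)) (avec j)) by do 2!apply: isvtx_add; apply: isvtx0.
have := edge_value_opp cpsi k v2; rewrite /edge_value third_tri // => ->.
by rewrite opprK.
Qed.

(** Collecting x, y, z gives multiples of f0 - f2, f1 - f0 and f2 - f1; the first is minus the sum
    of the other two. *)
Lemma boundary_ideal (K : fieldType) (f0 f1 f2 x y z : K) : f0 != 0 -> f1 != 0 -> f2 != 0 ->
  (f0 / f2) * x - y + (f1 / f0) * y - z + (f2 / f1) * z - x
  = (y / f0 - x / f2) * (f1 - f0) + (z / f1 - x / f2) * (f2 - f1).
Proof. by move=> h0 h1 h2; field; rewrite h0 h1 h2. Qed.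

Lemma fund_sum_coboundary phi : coboundary m P 2 phi -> inIdeal m P (fund_sum phi).
Proof.
case=> psi [cpsi e].
rewrite (@eq_fund_sum phi (delta 1 psi)); last by move=> i j ij; rewrite e //; apply: tri_simplex.
have va i : isvtx (vadd vzero (avec i)) by apply: isvtx_add isvtx0.
(* Opposite boundary edges of the hexagon are translates of each other by a root. *)
have tr i j l : edge_value psi l (vadd vzero (avec i)) = Fi i / Fi j * edge_value psi l (vadd vzero (avec j)).
  have := edge_value_vtr cpsi l (inLam_root i j) (va j); rewrite (uLam_root mP) => <-.
  by congr (edge_value _ _ _); rewrite vtr_add root_add.
have vc i j := vaddAC vzero i j.
exists (edge_value psi 2 (vadd vzero (avec 0)) / Fi 0 - edge_value psi 1 (vadd vzero (avec 2)) / Fi 2),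
       (edge_value psi 0 (vadd vzero (avec 1)) / Fi 1 - edge_value psi 1 (vadd vzero (avec 2)) / Fi 2).
split.
- by apply: inRFB; apply: inRFM; try exact: inRF_FtV; exact: edge_value_inRF.
- by apply: inRFB; apply: inRFM; try exact: inRF_FtV; exact: edge_value_inRF.
rewrite -boundary_ideal // -!tr fund_sumE.
rewrite (@delta_tri psi 0 1 2) // (@delta_tri psi 0 2 1) // (@delta_tri psi 1 2 0) //.
rewrite (@delta_tri psi 1 0 2) // (@delta_tri psi 2 0 1) // (@delta_tri psi 2 1 0) //.
rewrite (vc 1 0) (vc 2 0) (vc 2 1); ring.
Qed.

(* A [Lambda]-equivariant 1-cochain is given by its nine values [X c i] on the
   edges in direction [a_i] leaving a vertex of class [c]. *)
Section OneCochain.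
Variable X : int -> 'I_3 -> Kfr.
Hypothesis AX : forall c i, A (X c i).

Definition one_value i v := monom v * X (cls v) i.

Definition one_cochain (s : seq vtx) : Kfr :=
  if s is [:: x; y] then
    \sum_i ((if y == vadd x (avec i) then one_value i x else 0)
            - (if x == vadd y (avec i) then one_value i y else 0))
  else 0.

Lemma one_cochain_cochain : cochain m P 1 one_cochain.
Proof.
have Av i v : A (one_value i v) by apply: inRFM => //; apply: monom_inRF.
split.
- move=> s /simplex1P[x [y ->]]; apply: inRF_sum => i _.
  by apply: inRFB; case: ifP => _ //; apply: inRF0.
- move=> s1 x y s2 /andP[/andP[/eqP sz _] _]; move: sz; rewrite size_cat /=.
  case: s1 => [|a s1]; case: s2 => [|c s2] /= sz; try by lia.
  by rewrite -sumrN; apply: eq_bigr => i _; rewrite opprB.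
- move=> kk s kL /simplex1P[x [y ->]] /=; rewrite mulr_sumr; apply: eq_bigr => i _.
  rewrite -!vtr_add !(inj_eq (@vtr_inj kk)) /one_value !cls_vtr !monom_vtr.
  by case: ifP => _; case: ifP => _; ring.
Qed.

Lemma edge_value_one i v : edge_value one_cochain i v = one_value i v.
Proof.
rewrite /edge_value /= (bigD1 i) //= eqxx big1 => [|j ji].
  case: ifP => [/eqP e|_]; last by rewrite subr0 addr0.
  have := congr1 cls e; rewrite !cls_add; have := cls_range v; move: (cls v) => c; lia.
case: ifP => [/eqP /vadd_avec_inj e|_]; first by rewrite e eqxx in ji.
case: ifP => [/eqP e|_]; last by rewrite subr0.
have := congr1 cls e; rewrite !cls_add; have := cls_range v; move: (cls v) => c; lia.
Qed.

Lemma delta_one_tri i j k : i != j -> j != k -> i != k ->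
  delta 1 one_cochain (tri i j) = Fi i / Fp * X 2 j + (Fi k)^-1 * X 1 k + X 0 i.
Proof.
move=> ij jk ik; rewrite (delta_tri one_cochain_cochain ij jk ik) !edge_value_one.
have c0 : cls vzero = 0 by rewrite /cls ffunE.
have c2 : cls (vadd vzero (avec i)) = 2 by rewrite cls_add c0.
have c1 : cls (vadd (vadd vzero (avec i)) (avec j)) = 1 by rewrite cls_add c2.
by rewrite /one_value c0 c1 c2 monom0 monom_avec (monom_avec2 ij jk ik) mul1r.
Qed.

End OneCochain.

Lemma cochain_delta_alt psi : cochain m P 1 psi ->
  forall s1 x y s2, simplex 2 (s1 ++ x :: y :: s2) ->
    delta 1 psi (s1 ++ y :: x :: s2) = - delta 1 psi (s1 ++ x :: y :: s2).
Proof.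
move=> [_ alt _].
have psiC x y : edge x y -> psi [:: y; x] = - psi [:: x; y].
  by move=> xy; apply: (alt [::] x y [::]); rewrite simplex1.
move=> s1 x y s2 ss; have [[e1 [c e2]]|[[a e1] e2]] := simplex2_split ss; subst s1 s2.
- move: ss; rewrite simplex2 => /and3P[xy xc yc].
  by rewrite !delta1E (psiC _ _ xy); ring.
- move: ss; rewrite simplex2 => /and3P[ax ay xy].
  by rewrite !delta1E (psiC _ _ xy); ring.
Qed.

Lemma cochain_delta_vtr psi : cochain m P 1 psi ->
  forall kk s, inLam kk -> simplex 2 s -> delta 1 psi (map (vtr kk) s) = u kk * delta 1 psi s.
Proof.
move=> [_ _ e] kk s kL ss; have [x [y [z es]]] := simplex2P ss; subst s.
move: ss; rewrite simplex2 => /and3P[xy xz yz].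
have E a b : edge a b -> psi [:: vtr kk a; vtr kk b] = u kk * psi [:: a; b].
  by move=> ab; apply: (e kk [:: a; b]) => //; rewrite simplex1.
by rewrite /= !delta1E !E //; ring.
Qed.

(** A primitive amounts to solving six linear equations, one for each triangle at the origin. Five
    are solved successively inside R_F; the sixth is the ideal condition. *)
Lemma coboundary_of_ideal phi :
  cochain m P 2 phi -> inIdeal m P (fund_sum phi) -> coboundary m P 2 phi.
Proof.
move=> cphi [a [b [Aa Ab e]]]; case: (cphi) => Aphi _ _.
have At i j : i != j -> A (phi (tri i j)) by move=> ij; apply: Aphi; apply: tri_simplex.
(* The coefficients a and b and the zero values are free choices; the triangles 01, 02, 10, 20 and
   12 then determine the remaining unknowns. *)
pose y2 (j : 'I_3) : Kfr := if j == 0 then b else if j == 2 then a else 0.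
pose x1 := phi (tri 1 0) - Fi 1 * b - phi (tri 0 1).
pose z1 := phi (tri 0 2) - Fi 0 * a.
pose x0 (i : 'I_3) : Kfr := if i == 1 then x1
  else if i == 2 then phi (tri 2 0) - Fi 2 * b - z1 else 0.
pose zz (k : 'I_3) : Kfr := if k == 1 then z1 else if k == 2 then phi (tri 0 1)
  else phi (tri 1 2) - Fi 1 * a - x1.
(* The factors [Fp] and F_i cancel the denominators that [monom] produces at vertices of class 2 and
   1. *)
pose X (c : int) (i : 'I_3) : Kfr := if c == 2 then Fp * y2 i else if c == 1 then Fi i * zz i else x0 i.
have AF i := inRF_Ft m P i.
have Az1 : A z1 by apply: inRFB; [apply: At | apply: inRFM].
have Ax1 : A x1 by do 2?apply: inRFB; try exact: At; apply: inRFM.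
have AX c i : A (X c i).
  rewrite /X; case: ifP => _.
    apply: inRFM; first exact: inRF_Fprod.
    by rewrite /y2; do 2?case: ifP => _ //; apply: inRF0.
  case: ifP => _.
    apply: inRFM => //; rewrite /zz; case: ifP => // _; case: ifP => _; first exact: At.
    by do 2?apply: inRFB => //; [exact: At | apply: inRFM].
  rewrite /x0; case: ifP => // _; case: ifP => _; last exact: inRF0.
  by do 2?apply: inRFB => //; [exact: At | apply: inRFM].
have cX := one_cochain_cochain AX.
exists (one_cochain X); split => //.
have D i j k : i != j -> j != k -> i != k ->
    delta 1 (one_cochain X) (tri i j) = Fi i * y2 j + zz k + x0 i.
  move=> ij jk ik; rewrite (delta_one_tri AX ij jk ik) /X /=.
  by rewrite mulrA (divfK (Fprod_neq0 m P_neq0)) (mulKf (Fn0 k)).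
suff H i j : i != j -> phi (tri i j) - delta 1 (one_cochain X) (tri i j) = 0.
  move=> s ss; apply/eqP; rewrite -subr_eq0; apply/eqP.
  apply: (@alternating_ext (fun s => phi s - delta 1 (one_cochain X) s)) => //.
    move=> s1 x y s2 ss'; case: (cphi) => _ alt _.
    by rewrite alt // (cochain_delta_alt cX) //; ring.
  move=> kk s' kL ss'; case: (cphi) => _ _ eqv.
  by rewrite eqv // (cochain_delta_vtr cX) //; ring.
have e' := e; rewrite fund_sumE in e'.
(* The equation for the last triangle, read off from the ideal condition. *)
have p21 : phi (tri 2 1) = phi (tri 0 1) - phi (tri 0 2) + phi (tri 1 2) - phi (tri 1 0)
    + phi (tri 2 0) - (a * (Fi 1 - Fi 0) + b * (Fi 2 - Fi 1)) by rewrite -e'; ring.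
elim/ord3P: i; elim/ord3P: j => // _.
- rewrite (D 0 1 2) // /y2 /zz /x0 /=; ring.
- rewrite (D 0 2 1) // /y2 /zz /x0 /= /z1; ring.
- rewrite (D 1 0 2) // /y2 /zz /x0 /= /x1; ring.
- rewrite (D 1 2 0) // /y2 /zz /x0 /=; ring.
- rewrite (D 2 0 1) // /y2 /zz /x0 /=; ring.
- rewrite (D 2 1 0) // /y2 /zz /x0 /= p21 /x1 /z1; ring.
Qed.

Lemma inIdeal0 : inIdeal m P 0.
Proof. by exists 0, 0; split; try exact: inRF0; rewrite !mul0r addr0. Qed.

Lemma fund_sumB phi psi : fund_sum (fun s => phi s - psi s) = fund_sum phi - fund_sum psi.
Proof. by rewrite !fund_sumE; ring. Qed.

Lemma fund_sumZ c phi : fund_sum (fun s => c * phi s) = c * fund_sum phi.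
Proof. by rewrite !fund_sumE; ring. Qed.

Lemma fund_sum_inRF phi : cochain m P 2 phi -> A (fund_sum phi).
Proof.
move=> [Aphi _ _]; rewrite fund_sumE.
by repeat first [apply: inRFB | apply: inRFD]; apply: Aphi; apply: tri_simplex.
Qed.

End DegreeTwo.

(** * The equivariant cohomology and its Weyl action *)

Theorem theorem5p10 (R : realType) (F : expfun R) (m : nat) (P : {poly int}) :
  is_exponential_functor F ->
  character_is F m P ->
  (m < (size P).-1)%N ->
  (* H^k = 0 for k <> 2 *)
  (forall k : nat, k != 2%N ->
     forall phi, cochain m P k phi -> cocycle k phi -> coboundary m P k phi) /\
  (* H^2 is isomorphic to R_F(T^2) (x) Q / (F(t2) - F(t1), F(t3) - F(t2)),
     compatibly with W acting on the right-hand side by signed permutations *)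
  (exists Psi : Kfr -> seq vtx -> Kfr,
     [/\ (forall p, inRF m P p -> cochain m P 2 (Psi p)),
         (forall a p q, inRF m P a -> inRF m P p -> inRF m P q ->
            forall s, simplex 2 s -> Psi (a * p + q) s = a * Psi p s + Psi q s),
         (forall phi, cochain m P 2 phi ->
            exists p, inRF m P p /\ coboundary m P 2 (fun s => phi s - Psi p s)),
         (forall p, inRF m P p -> (coboundary m P 2 (Psi p) <-> inIdeal m P p)) &
         (forall (w : 'S_3) p, inRF m P p ->
            coboundary m P 2
              (fun s => wact w (Psi p) s - (-1) ^+ odd_perm w * Psi (sigmaW w p) s))]).
Proof.
move=> expF charF mP.
have P0 : P != 0 by apply: contraTneq mP => ->; rewrite size_poly0.
have rootP (z : R[i]) : root (map_poly intr P) z -> z <= 0 := @character_root_le0 _ _ _ _ expF charF P0 z.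
split.
  case=> [|[|[|k]]] // _ phi cphi zphi.
  - exact: cohomology0 mP _ cphi zphi.
  - exact: (@cohomology1 m P mP (R[i] : numClosedFieldType) rootP).
  - exact: (@no_high_cohomology m P k.+3 phi isT).
exists (Psi m P); split.
- exact: Psi_cochain.
- by move=> a p q _ _ _ s _; rewrite /Psi; ring.
(* There are no 3-simplices, so every 2-cochain is a cocycle. Subtracting [Psi] of its sum makes the
   sum vanish, and 0 lies in the ideal. *)
- move=> phi cphi; have Aphi := fund_sum_inRF cphi.
  exists (fund_sum phi); split=> //.
  apply: coboundary_of_ideal => //; first by apply: cochain_sub => //; apply: Psi_cochain.
  by rewrite fund_sumB fund_sum_Psi subrr; apply: inIdeal0.
- move=> p Ap; split=> [/(fund_sum_coboundary mP)|Ip]; first by rewrite fund_sum_Psi.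
  by apply: coboundary_of_ideal => //; [exact: Psi_cochain | rewrite fund_sum_Psi].
- move=> w p Ap; have Aw := inRF_sigmaW w Ap.
  apply: coboundary_of_ideal => //.
    apply: cochain_sub; first by apply: cochain_wact => //; apply: Psi_cochain.
    by apply: cochain_scale_sign; apply: Psi_cochain.
  rewrite fund_sumB fund_sum_wact (fund_sumZ _ (Psi m P _)) !fund_sum_Psi subrr.
  exact: inIdeal0.
Qed.
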